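(* Let $R$ be a finite commutative principal ring. Then $R \simeq R_1 \times R_2 \times \cdots \times R_n$, where for each $i=1,2,\ldots,n$ the ring $R_i$ is a local chain ring with Jacobson radical $J_i$ of nilpotency order $n_i$. Moreover, writing $\dim_M(\mathbb{AG}(R))$ for the metric dimension of the annihilating-ideal graph $\mathbb{AG}(R)$ of $R$, the following statements hold. (1) If $n=1$, then $\dim_M(\mathbb{AG}(R)) = \left\lfloor \frac{n_1-1}{2} \right\rfloor$. (2) If $n=2$, then $\dim_M(\mathbb{AG}(R)) = n_1+n_2-2+\epsilon$, where $\epsilon=1$ if $R_1$ and $R_2$ are both fields and $\epsilon=0$ otherwise. (3) If $n\geq 3$, then $$\left(\sum_{i=1}^n n_i\right)-n+\epsilon \;\leq\; \dim_M(\mathbb{AG}(R)) \;\leq\; \sum_{i=1}^n n_i,$$ where $\epsilon=0$ if none of $R_1,R_2,\ldots,R_n$ are fields, and otherwise $\epsilon=\lceil \log_2(\beta)\rceil$, where $\beta$ denotes the number of indices $i$ such that $R_i$ is a field.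
   Context: Rings are nonzero and have an identity element. A principal ring is a ring in which every ideal is principal. A chain ring is a ring whose ideals form a chain under inclusion. The Jacobson radical $J$ of a finite commutative ring is nilpotent; its nilpotency order is the $m\in\mathbb{N}$ (positive integer) such that $J^m=0$ and $J^{m-1}\neq 0$, with the convention that $J^0$ is the whole ring (so a field has radical $0$ of nilpotency order $1$). For a commutative ring $R$, the annihilating-ideal graph $\mathbb{AG}(R)$ is the simple graph whose vertices are the nonzero ideals of $R$ having nontrivial (nonzero) annihilator, with an edge between two distinct vertices $I$ and $J$ if and only if $IJ=0$. The distance $d(x,y)$ between vertices of a graph is the length of a shortest path between them. For an ordered subset $W=\{w_1,\ldots,w_k\}$ of the vertex set of a graph $G$ and a vertex $v$, the representation of $v$ with respect to $W$ is $r(v|W)=(d(v,w_1),\ldots,d(v,w_k))$. The set $W$ is a resolving set for $G$ if distinct vertices of $G$ have distinct representations with respect to $W$. The metric dimension $\dim_M(G)$ is the minimal cardinality of a resolving set for $G$ (the empty set is a resolving set for a graph with at most one vertex, so such a graph has metric dimension $0$). *)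

(* Defs.v *)
From HB Require Import structures.
From mathcomp Require Import all_boot all_order all_algebra.

Set Implicit Arguments.
Unset Strict Implicit.
Unset Printing Implicit Defensive.

Import GRing.Theory.
Local Open Scope ring_scope.

(* Only a PzRing, since the product over an empty index type is the zero ring. *)
Section ProductRing.

Variables (I : finType) (S : I -> pzRingType).
Local Notation prodS := {dffun forall i : I, S i}.
Implicit Types x y z : prodS.

Definition prod_zero : prodS := [ffun i => 0 : S i].
Definition prod_one : prodS := [ffun i => 1 : S i].
Definition prod_opp x : prodS := [ffun i => - x i].
Definition prod_add x y : prodS := [ffun i => x i + y i].
Definition prod_mul x y : prodS := [ffun i => x i * y i].

Fact prod_addA : associative prod_add.
Proof. by move=> x y z; apply/ffunP => i; rewrite !ffunE addrA. Qed.
Fact prod_addC : commutative prod_add.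
Proof. by move=> x y; apply/ffunP => i; rewrite !ffunE addrC. Qed.
Fact prod_add0 : left_id prod_zero prod_add.
Proof. by move=> x; apply/ffunP => i; rewrite !ffunE add0r. Qed.
Fact prod_addN : left_inverse prod_zero prod_opp prod_add.
Proof. by move=> x; apply/ffunP => i; rewrite !ffunE addNr. Qed.
Fact prod_mulA : associative prod_mul.
Proof. by move=> x y z; apply/ffunP => i; rewrite !ffunE mulrA. Qed.
Fact prod_mul1 : left_id prod_one prod_mul.
Proof. by move=> x; apply/ffunP => i; rewrite !ffunE mul1r. Qed.
Fact prod_mulr1 : right_id prod_one prod_mul.
Proof. by move=> x; apply/ffunP => i; rewrite !ffunE mulr1. Qed.
Fact prod_mulDl : left_distributive prod_mul prod_add.
Proof. by move=> x y z; apply/ffunP => i; rewrite !ffunE mulrDl. Qed.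
Fact prod_mulDr : right_distributive prod_mul prod_add.
Proof. by move=> x y z; apply/ffunP => i; rewrite !ffunE mulrDr. Qed.

HB.instance Definition _ :=
  GRing.isZmodule.Build prodS prod_addA prod_addC prod_add0 prod_addN.
HB.instance Definition _ :=
  GRing.Zmodule_isPzRing.Build prodS
    prod_mulA prod_mul1 prod_mulr1 prod_mulDl prod_mulDr.

End ProductRing.

Section Ideals.

Variable R : finComNzRingType.
Implicit Types (I J M A : {set R}) (a : R) (m : nat).

(* [idealr_closed] of ring_quotient only covers proper ideals. *)
Definition is_ideal I : bool :=
  (0 \in I) && [forall a, forall x in I, forall y in I, a * x + y \in I].

Definition ideal_gen A : {set R} :=
  \bigcap_(I : {set R} | is_ideal I && (A \subset I)) I.

Definition ideal_mul I J : {set R} := ideal_gen [set x * y | x in I, y in J].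

Definition ideal_exp I m : {set R} := iter m (ideal_mul I) [set: R].

Definition annihilator I : {set R} := [set r | [forall x in I, r * x == 0]].

Definition principal_ring : Prop :=
  forall I, is_ideal I -> exists a, I = ideal_gen [set a].

Definition chain_ring : Prop :=
  forall I J, is_ideal I -> is_ideal J -> I \subset J \/ J \subset I.

Definition maximal_ideal M : bool :=
  maxset (fun I => is_ideal I && (I != [set: R])) M.

Definition local_ring : Prop := exists! M, maximal_ideal M.

Definition jacobson : {set R} := \bigcap_(M : {set R} | maximal_ideal M) M.

Definition nilpotency_order I m : Prop :=
  [/\ (0 < m)%N, ideal_exp I m = [set 0] & ideal_exp I m.-1 <> [set 0]].

Definition is_field : bool :=
  [forall x : R, (x != 0) ==> [exists y : R, x * y == 1]].

End Ideals.

Section MetricDimension.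

Variables (V : finType) (e : rel V).
Implicit Types (x y v : V) (W : {set V}).

Definition joined_by_path k x y : bool :=
  [exists p : k.-tuple V, [&& path e x p, uniq (x :: p) & last x p == y]].

(* A path has fewer than #|V| edges; if y is unreachable from x, the value is
   #|V|, which plays the role of an infinite distance. *)
Definition gdist x y : nat :=
  find (fun k => joined_by_path k x y) (iota 0 #|V|).

(* W is ordered by the canonical enumeration of V. *)
Definition representation W v : seq nat := [seq gdist v w | w <- enum W].

Definition resolving W : bool := injectiveb (representation W).

(* [set: V] is always resolving, so the minimum is attained. *)
Definition metric_dim : nat := #|[arg min_(W < [set: V] | resolving W) #|W|]|.

End MetricDimension.

Section AnnihilatingIdealGraph.

Variable R : finComNzRingType.

Definition AG_vertex (I : {set R}) : bool :=
  [&& is_ideal I, I != [set 0] & annihilator I != [set 0]].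

Definition AG_edge : rel {I : {set R} | AG_vertex I} :=
  fun I J => (I != J) && (ideal_mul (val I) (val J) == [set 0]).

End AnnihilatingIdealGraph.

Definition dim_AG (R : finComNzRingType) : nat := metric_dim (@AG_edge R).

Definition chain_decomposition (R : finComNzRingType) (n : nat)
    (S : 'I_n -> finComNzRingType) (m : 'I_n -> nat) : Prop :=
  (exists f : {rmorphism R -> {dffun forall i : 'I_n, S i}}, bijective f) /\
  (forall i : 'I_n, [/\ local_ring (S i), chain_ring (S i)
                      & nilpotency_order (jacobson (S i)) (m i)]).

(* [up_log 2 b] is the least k with b <= 2 ^ k. *)
Definition ceil_log2 (b : nat) : nat := up_log 2 b.

(* Main.v *)
(* Cutting R by its primitive idempotents gives local factors with nilpotent
   principal maximal ideals (p_i), so every ideal of R is generated by a product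
   of powers p_i^{a_i} with 0 <= a_i <= n_i. Writing N = (n_i), the graph becomes:
   vertices a <> 0, N; an edge a -- b when a + b >= N; distance 2 when a and b are
   not adjacent but have a common support index; distance 3 otherwise.

   On the line c e_i (1 <= c <= n_i) the vertices c e_i and d e_i, c < d, outside
   a resolving set W are told apart only by some N - t e_i in W with c < t <= d.
   Hence at least n_i - 1 elements of W lie on the lines {c e_i} and {N - t e_i}.
   For n >= 3 these pairs of lines are disjoint for different i, while two vectors
   e_i, e_j from field factors are told apart only by an element outside the lines
   of the nonfields whose support contains exactly one of i, j; this gives the
   logarithm. All the N - t e_i together resolve the graph.

   For n = 2 the lines overlap in (n_1, 0) and (0, n_2). If every row 0 < b < n_2
   meets W, these rows and the line of index 1 give disjoint contributions;
   a row missing W needs n_1 - 1 thresholds off the line of index 2. *)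

Require Import Defs.
From HB Require Import structures.
From mathcomp Require Import all_boot all_order all_algebra.
From mathcomp Require Import zify ring.

Set Implicit Arguments.
Unset Strict Implicit.
Unset Printing Implicit Defensive.

(** * Distance and metric dimension *)

Section MetricDimensionTheory.

Variables (V : finType) (e : rel V).
Implicit Types (x y w : V) (W A : {set V}).

Lemma joined0 x y : joined_by_path e 0 x y = (x == y).
Proof.
apply/existsP/eqP => [[p]|->]; first by rewrite tuple0 /= => /eqP.
by exists [tuple] => /=.
Qed.

Lemma joined1 x y : joined_by_path e 1 x y = e x y && (x != y).
Proof.
apply/existsP/andP => [[p]|[exy nxy]].
  case/tupleP: p => a p; rewrite tuple0 /= !andbT inE.
  by case/and3P => exa nxa /eqP <-.
by exists [tuple y]; rewrite /= inE exy nxy /=.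
Qed.

Lemma joined2 x y : joined_by_path e 2 x y =
  [exists z, [&& e x z, e z y, x != z, z != y & x != y]].
Proof.
apply/existsP/existsP => [[p]|[z /and5P[exz ezy nxz nzy nxy]]].
  case/tupleP: p => a p; case/tupleP: p => b p; rewrite tuple0 /= !andbT !inE.
  rewrite negb_or; case/and3P => /andP[exa eab] /andP[/andP[nxa nxb] nab] /eqP <-.
  by exists a; rewrite exa eab nxa nab nxb.
by exists [tuple z; y]; rewrite /= !inE negb_or exz ezy nxz nzy nxy /=.
Qed.

Lemma joined_by_path_lt k x y : joined_by_path e k x y -> k < #|V|.
Proof.
case/existsP => p /and3P[_ up _].
by rewrite -(size_tuple p) -[_.+1]/(size (x :: p)) -(card_uniqP up) max_card.
Qed.

(** A simple path has fewer than [#|V|] edges, so [k] lies in the range searched by [gdist], and no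
    smaller length stops the search. *)
Lemma gdistE k x y : joined_by_path e k x y ->
  (forall j, j < k -> ~~ joined_by_path e j x y) -> gdist e x y = k.
Proof.
move=> jk nj; have ltk := joined_by_path_lt jk.
rewrite /gdist -(subnKC ltk) -addn1 -addnA add1n iotaD add0n find_cat.
have -> : has (fun k0 => joined_by_path e k0 x y) (iota 0 k) = false.
  by apply/hasPn => j; rewrite mem_iota add0n => /nj.
by rewrite size_iota /= jk addn0.
Qed.

Lemma resolvingP W :
  reflect (forall x y, x != y -> exists2 w, w \in W & gdist e x w != gdist e y w)
          (resolving e W).
Proof.
rewrite /resolving; apply: (iffP (injectiveP _)) => [injW x y nxy|sepW x y eqxy].
  have /allPn[w] : ~~ all (fun w => gdist e x w == gdist e y w) (enum W).
    apply: contra nxy => /allP eqW; apply/eqP/injW.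
    by apply/eq_in_map => w /eqW/eqP.
  by rewrite mem_enum; exists w.
case: (x =P y) => // /eqP /sepW[w wW].
by move/eq_in_map: eqxy => ->; rewrite ?eqxx ?mem_enum.
Qed.

Lemma gdistxx x : gdist e x x = 0.
Proof. by apply: gdistE => //; rewrite joined0. Qed.

Lemma gdist_eq0 x y : (gdist e x y == 0) = (x == y).
Proof.
apply/eqP/eqP => [|->]; last exact: gdistxx.
have V0 : 0 < #|V| by apply/card_gt0P; exists x.
rewrite /gdist -(prednK V0) /= joined0; by case: eqP.
Qed.

Lemma resolving_setT : resolving e [set: V].
Proof.
by apply/resolvingP => x y nxy; exists y; rewrite ?inE // gdistxx gdist_eq0.
Qed.

Lemma metric_dim_le W : resolving e W -> metric_dim e <= #|W|.
Proof.
by rewrite /metric_dim; case: arg_minnP => [|W0 _ minW /minW//];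
  exact: resolving_setT.
Qed.

Lemma metric_dim_ge k :
  (forall W, resolving e W -> k <= #|W|) -> k <= metric_dim e.
Proof.
by rewrite /metric_dim; case: arg_minnP => [|W0 rW0 _ /(_ _ rW0)//];
  exact: resolving_setT.
Qed.

Lemma count_mem_le_card (s : seq V) W A : uniq s ->
  (forall x, x \in s -> x \in W -> x \in A) -> count (mem W) s <= #|A|.
Proof.
move=> us sWA; rewrite -size_filter cardE; apply: uniq_leq_size.
  exact: filter_uniq.
by move=> x; rewrite mem_filter mem_enum => /andP[xW xs]; apply: sWA.
Qed.

Lemma size_le_card (T : eqType) (g : V -> T) (s : seq T) A : uniq s ->
  (forall b, b \in s -> exists2 x, x \in A & g x = b) -> size s <= #|A|.
Proof.
move=> us sA; rewrite cardE -(size_map g); apply: uniq_leq_size => // b.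
by case/sA => x xA <-; rewrite map_f ?mem_enum.
Qed.

End MetricDimensionTheory.

(* Between two consecutive indices outside P there is an index satisfying Q;
   the second disjunct of the invariant records that the last gap is open. *)
Lemma chain_count n (P Q : pred nat) :
  (forall c d, 0 < c -> c < d -> d <= n -> ~~ P c -> ~~ P d ->
     exists t, [/\ c < t, t <= d & Q t]) ->
  n <= (count P (iota 1 n) + count Q (iota 2 n.-1)).+1.
Proof.
move=> gap.
have inv k : k <= n -> let s := count P (iota 1 k) + count Q (iota 2 k.-1) in
    k <= s \/ [/\ k <= s.+1 & exists c, [/\ 0 < c, c <= k, ~~ P c &
      forall t, c < t -> t <= k -> ~~ Q t]].
  elim: k => [|k IHk] ltkn; first by left.
  have eP : count P (iota 1 k.+1) = count P (iota 1 k) + P k.+1.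
    by rewrite -[in LHS](addn1 k) iotaD count_cat /= addn0 add1n.
  have eQ : count Q (iota 2 k) = count Q (iota 2 k.-1) + ((0 < k) && Q k.+1).
    case: k {IHk ltkn eP} => [//|k].
    by rewrite -[in LHS](addn1 k) iotaD count_cat /= addn0 add2n.
  rewrite eP -[k.+1.-1]/k eQ; case: (IHk (ltnW ltkn)) => /= [A|[B [c [c0 ck nPc nQ]]]].
    case: (boolP (P k.+1)) => Pk; first by left; lia.
    by right; split; [lia | exists k.+1; split=> // t; lia].
  have k0 : 0 < k by lia.
  case: (boolP (Q k.+1)) => Qk; case: (boolP (P k.+1)) => Pk; rewrite k0 /=.
  - by left; lia.
  - by right; split; [lia | exists k.+1; split=> // t; lia].
  - right; split; [lia | exists c; split=> //; first lia].
    move=> t ct; rewrite leq_eqVlt => /orP[/eqP->//|]; exact: nQ.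
  (* No index after [c] up to [k] satisfies [Q], so the index given by [gap] must be [k.+1], where
     [Q] fails. *)
  - have [t [ct tk Qt]] := gap c k.+1 c0 (ck : c < k.+1) ltkn nPc Pk.
    have: t = k.+1.
      by apply/eqP; rewrite eqn_leq tk ltnNge; apply/negP => /(nQ _ ct)/negP.
    by move=> et; rewrite -et Qt in Qk.
by case: (inv n (leqnn n)) => /= [|[]]; lia.
Qed.
(** * Graphs of exponent vectors *)

Section ExponentGraph.

Variables (V : finType) (edge : rel V) (I : finType).
Variables (N : I -> nat) (lev : V -> I -> nat).

(** This is the vanishing of the product of two ideals. It can hold with [v = w], whereas adjacency
    requires distinct vertices. *)
Definition annihilates (v w : V) : bool := [forall i, N i <= lev v i + lev w i].
Definition meets (v w : V) : bool := [exists i, (0 < lev v i) && (0 < lev w i)].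
Definition others (i : I) : bool := [exists j, j != i].

Hypothesis N_gt0 : forall i, 0 < N i.
Hypothesis lev_inj : forall v w, lev v =1 lev w -> v = w.
Hypothesis lev_le : forall v i, lev v i <= N i.
Hypothesis lev_gt0 : forall v, exists i, 0 < lev v i.
Hypothesis lev_ltN : forall v, exists i, lev v i < N i.
Hypothesis lev_onto : forall a : I -> nat, (forall i, a i <= N i) ->
  (exists i, 0 < a i) -> (exists i, a i < N i) -> exists v, lev v =1 a.
Hypothesis edgeE : forall v w, edge v w = (v != w) && annihilates v w.

Implicit Types (v w : V) (W A : {set V}).

(** [N - lev v] is the exponent vector of the annihilator; it avoids [0] and [N] because [lev v]
    does. *)
Lemma exists_coexponent v : exists u, forall i, lev u i = N i - lev v i.
Proof.
apply: lev_onto => [i||]; first exact: leq_subr.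
  by have [i] := lev_ltN v; exists i; rewrite subn_gt0.
by have [i] := lev_gt0 v; exists i; have := N_gt0 i; lia.
Qed.

Lemma not_annihilates_self v w : ~~ meets v w -> ~~ annihilates v v.
Proof.
move=> nm; have [i wi] := lev_gt0 w; apply/forallPn; exists i.
have := existsPn nm i; rewrite wi andbT lt0n negbK => /eqP ->.
by rewrite -ltnNge.
Qed.

(** With a common support index, [v] and [w] have a common neighbour. Without one, their
    annihilators annihilate each other and give a path of length 3. *)
Lemma gdist_exponent v w : gdist edge v w =
  if v == w then 0 else if annihilates v w then 1 else if meets v w then 2 else 3.
Proof.
case: eqP => [->|/eqP nvw]; first exact: gdistxx.
have n0 : ~~ joined_by_path edge 0 v w by rewrite joined0.
case: ifP => avw.
  by apply: gdistE => [|[|//] _]; rewrite ?joined1 ?edgeE ?nvw ?avw.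
have n1 : ~~ joined_by_path edge 1 v w by rewrite joined1 edgeE avw andbF.
case: ifP => [/existsP[k /andP[vk wk]]|/negbT nm].
  apply: gdistE => [|[|[|//]] _] //.
  (* This is the least exponent vector annihilating both [v] and [w]; the common support index [k]
     makes it different from [N]. *)
  have [|||u levu] := @lev_onto (fun i => N i - minn (lev v i) (lev w i)).
  - by move=> i; apply: leq_subr.
  - by have [i] := lev_ltN v; exists i; lia.
  - by exists k; have := N_gt0 k; lia.
  have avu : annihilates v u.
    by apply/forallP => i; rewrite levu; lia.
  have auw : annihilates u w.
    by apply/forallP => i; rewrite levu; lia.
  rewrite joined2; apply/existsP; exists u; rewrite !edgeE avu auw nvw !andbT.
  have -> : v != u by apply/eqP => evu; rewrite -evu avw in auw.
  by have -> : u != w by apply/eqP => euw; rewrite euw avw in avu.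
have [u levu] := exists_coexponent v; have [z levz] := exists_coexponent w.
have avu : annihilates v u by apply/forallP => i; rewrite levu; have := lev_le v i; lia.
have azw : annihilates z w by apply/forallP => i; rewrite levz; have := lev_le w i; lia.
have auz : annihilates u z.
  apply/forallP => i; rewrite levu levz; have := existsPn nm i.
  by move: (lev_le v i) (lev_le w i); clear; lia.
have nvu : v != u.
  by apply/eqP => evu; have := not_annihilates_self nm; rewrite {2}evu avu.
have nzw : z != w.
  apply/eqP => ezw; have := @not_annihilates_self w v.
  rewrite -{2}ezw azw /meets => /(_ _)/negP[]//; apply: contra nm => /existsP[i].
  by rewrite andbC => ?; apply/existsP; exists i.
have nuw : u != w by apply/eqP => euw; rewrite euw avw in avu.
have nvz : v != z by apply/eqP => evz; rewrite -evz avw in azw.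
have nuz : u != z.
  apply: contra nvw => /eqP euz; apply/eqP/lev_inj => i.
  by have := levu i; rewrite euz levz; move: (lev_le v i) (lev_le w i); clear; lia.
apply: gdistE => [|[|[|[|//]]] _] //.
  apply/existsP; exists [tuple u; z; w] => /=.
  by rewrite !edgeE !inE !negb_or avu auz azw nvu nzw nuw nvz nuz nvw /=.
(* A common neighbour [y] is below [N] at some index, and there both [v] and [w] must be
   positive. *)
rewrite joined2; apply: contra nm => /existsP[y].
rewrite !edgeE => /and5P[/andP[_ /forallP avy] /andP[_ /forallP ayw] _ _ _].
have [i yi] := lev_ltN y; apply/existsP; exists i.
by move: yi (avy i) (ayw i); clear; lia.
Qed.

(** The distance from [v] to [u] is at most 1, that from [w] is at least 2 unless [w = u]; in that
    case [v] and [u] are distinct. *)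
Lemma annihilates_separates v w u : annihilates v u ->
  ~~ annihilates w u -> gdist edge v u != gdist edge w u.
Proof.
move=> avu /negbTE nwu; rewrite !gdist_exponent avu nwu.
have nwv : v != w by apply/eqP => evw; rewrite -evw avu in nwu.
have [euw|_] := eqVneq w u; last by case: (v == u) => //; case: (meets w u).
by rewrite -euw (negPf nwv).
Qed.

(** * The lines [c e_i] and [N - t e_i] *)

Variable x0 : V.

(* The junk value [x0] is returned when [a] is 0, N or not bounded by N. *)
Definition vertex_of (a : I -> nat) : V :=
  odflt x0 [pick v | [forall i, lev v i == a i]].
(** [axis i c] is [c e_i], and [coaxis i t] is [N - t e_i], the annihilator of [t e_i]. When the
    latter is a vertex, [v] annihilates it exactly if [t <= lev v i]: it tests one threshold of one
    coordinate. *)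
Definition axis (i : I) (c : nat) : V := vertex_of (fun j => if j == i then c else 0).
Definition coaxis (i : I) (t : nat) : V :=
  vertex_of (fun j => if j == i then N i - t else N j).

Lemma vertex_of_lev v (a : I -> nat) : lev v =1 a -> vertex_of a = v.
Proof.
move=> va; rewrite /vertex_of; case: pickP => [w /forallP wa|/(_ v)/negP[]] /=.
  by apply: lev_inj => i; rewrite va; apply/eqP.
by apply/forallP => i; apply/eqP.
Qed.

Lemma lev_vertex_of (a : I -> nat) : (forall i, a i <= N i) ->
  (exists i, 0 < a i) -> (exists i, a i < N i) -> lev (vertex_of a) =1 a.
Proof. by move=> aN a0 aNN; have [v va] := lev_onto aN a0 aNN; rewrite (vertex_of_lev va). Qed.

(* The bound excludes c = N i exactly when i is the only index, where N i * e_i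
   is the zero ideal. *)
Lemma lev_axis i c : 0 < c < N i + others i ->
  forall j, lev (axis i c) j = if j == i then c else 0.
Proof.
move=> /andP[c0 ltc]; apply: lev_vertex_of => [j||].
- by case: eqP => // ->; move: ltc; case: (others i); lia.
- by exists i; rewrite eqxx.
have [lt|ge] := ltnP c (N i); first by exists i; rewrite eqxx.
move: ltc; rewrite /others; case: existsP => [[j nij] _|]; last by lia.
by exists j; rewrite (negPf nij).
Qed.

Lemma lev_coaxis i t : 0 < t < N i + others i ->
  forall j, lev (coaxis i t) j = if j == i then N i - t else N j.
Proof.
move=> /andP[t0 ltt]; apply: lev_vertex_of => [j||].
- by case: eqP => // ->; apply: leq_subr.
- have [lt|ge] := ltnP t (N i); first by exists i; rewrite eqxx subn_gt0.
  move: ltt; rewrite /others; case: existsP => [[j nij] _|]; last by lia.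
  by exists j; rewrite (negPf nij).
by exists i; rewrite eqxx; have := N_gt0 i; lia.
Qed.

(** Both points have the same support, so only annihilation can separate them. A [w] annihilated by
    [d e_i] but not by [c e_i] is full away from [i], and [N i - lev w i] lies above [c] and is at
    most [d]. *)
Lemma axis_gap W i c d : resolving edge W -> 0 < c -> c < d ->
  d < N i + others i -> axis i c \notin W -> axis i d \notin W ->
  exists t, [/\ c < t, t <= d & coaxis i t \in W].
Proof.
move=> /resolvingP rW c0 cd dN nc nd.
have levc : forall j, lev (axis i c) j = if j == i then c else 0 by apply: lev_axis; lia.
have levd : forall j, lev (axis i d) j = if j == i then d else 0 by apply: lev_axis; lia.
have [|w wW] := rW (axis i c) (axis i d).
  by apply/eqP => e; have := levc i; rewrite e levd eqxx; lia.
rewrite !gdist_exponent.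
have -> : (axis i c == w) = false by apply: contraNF nc => /eqP->.
have -> : (axis i d == w) = false by apply: contraNF nd => /eqP->.
have -> : meets (axis i c) w = meets (axis i d) w.
  apply: eq_existsb => j; rewrite levc levd; case: (j == i) => //.
  by rewrite c0 (ltn_trans c0 cd).
case: (boolP (annihilates (axis i d) w)) => [/forallP ad|nad]; last first.
  suff -> : annihilates (axis i c) w = false by rewrite eqxx.
  apply: contraNF nad => /forallP ac; apply/forallP => j.
  by have := ac j; rewrite levc levd; case: (j == i); lia.
case: (boolP (annihilates (axis i c) w)) => [//|/forallPn[k]]; rewrite levc => nk _.
have ki : k = i by move: nk (ad k); rewrite levd; case: (k =P i) => // _; lia.
rewrite ki eqxx -ltnNge in nk; have := ad i; rewrite levd eqxx => di.
exists (N i - lev w i); split; [lia | lia | ].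
rewrite /coaxis (@vertex_of_lev w) // => j.
case: (j =P i) => [->|/eqP/negPf nji]; first by rewrite subKn.
by apply/eqP; rewrite eqn_leq lev_le; have := ad j; rewrite levd nji.
Qed.

Lemma line_count W i k : resolving edge W -> k < N i + others i ->
  k <= (count (mem W) [seq axis i c | c <- iota 1 k] +
        count (mem W) [seq coaxis i t | t <- iota 2 k.-1]).+1.
Proof.
move=> rW kN; rewrite !count_map; apply: chain_count => c d c0 cd dk nc nd.
by apply: axis_gap rW _ _ _ nc nd => //; apply: leq_ltn_trans kN.
Qed.

Lemma uniq_axis i k : k < N i + others i -> uniq [seq axis i c | c <- iota 1 k].
Proof.
move=> kN; rewrite map_inj_in_uniq ?iota_uniq // => c d.
rewrite !mem_iota => cP dP e; have := @lev_axis i c _ i.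
by rewrite e lev_axis ?eqxx; lia.
Qed.

Lemma uniq_coaxis i k : k <= N i + others i -> uniq [seq coaxis i t | t <- iota 2 k.-2].
Proof.
move=> kN; rewrite map_inj_in_uniq ?iota_uniq // => c d.
rewrite !mem_iota => cP dP e; have := @lev_coaxis i c _ i.
rewrite e lev_coaxis ?eqxx; last by lia.
have : others i <= 1 by case: (others i).
have := N_gt0 i; lia.
Qed.

(** [A] collects the points of [W] on the two lines of [i]. The threshold [t = N i] is excused when
    [axis i (N i)] is in [W], since that point makes up for it; for two indices, [coaxis i (N i)] is
    also the end of the other axis. *)
Lemma line_card W A i : resolving edge W -> others i ->
  (forall c, 0 < c <= N i -> axis i c \in W -> axis i c \in A) ->
  (forall t, 1 < t -> t + (axis i (N i) \in W) <= N i ->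
     coaxis i t \in W -> coaxis i t \in A) ->
  N i - 1 <= #|A|.
Proof.
move=> rW oi axA coA; pose b := axis i (N i) \in W; pose k := N i - b.
have bN : b <= N i := leq_trans (leq_b1 _) (N_gt0 i).
pose s := [seq axis i c | c <- iota 1 (N i)] ++ [seq coaxis i t | t <- iota 2 k.-1].
have NkN : N i < N i + others i by rewrite oi addn1.
have le_sA : count (mem W) s <= #|A|.
  apply: count_mem_le_card => [|v].
    rewrite cat_uniq uniq_axis // -[k.-1]/(k.+1.-2) uniq_coaxis ?andbT /=; last by lia.
    (* At an index other than [i], a [coaxis] vector is positive and an [axis] vector is zero, so
       the two lists are disjoint. *)
    apply/hasPn => v /mapP[t]; rewrite mem_iota => tP ->; apply/mapP => -[c].
    rewrite mem_iota => cP e; have /existsP[j nji] := oi.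
    have := @lev_coaxis i t _ j; rewrite e lev_axis ?(negPf nji); last by lia.
    by have := N_gt0 j; lia.
  rewrite mem_cat => /orP[]/mapP[c]; rewrite mem_iota => cP ->; first by apply: axA; lia.
  by apply: coA; rewrite -/b; lia.
apply: leq_trans le_sA; rewrite {}/s count_cat.
have := line_count rW NkN; have := @line_count W i (N i).-1 rW.
rewrite {bN coA}/k {k}/b {b}; case eb: (_ \in W) => /=; last by rewrite subn0; lia.
(* With [axis i (N i)] in [W], the line is counted up to [N i - 1] only, and this point supplies the
   missing unit. *)
rewrite subn1 => lc _; rewrite -[in iota 1 _](prednK (N_gt0 i)) -(addn1 (N i).-1).
rewrite iotaD map_cat count_cat.
rewrite /= addn0 add1n prednK ?N_gt0 // eb.
have /lc : (N i).-1 < N i + others i by have := N_gt0 i; lia.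
lia.
Qed.

(** * Bounds by the sum of the [N i] *)

(** All the points [N - t e_i] resolve the graph: if [lev x i < lev y i], the threshold
    [t = lev y i] is annihilated by [y] and not by [x]. *)
Lemma metric_dim_le_sum : (forall i, others i) -> metric_dim edge <= \sum_i N i.
Proof.
move=> oth; pose s := flatten [seq [seq coaxis i t | t <- iota 1 (N i)] | i <- enum I].
have <- : size s = \sum_i N i.
  rewrite size_flatten /shape -map_comp sumnE big_map big_enum /=.
  by apply: eq_bigr => i _; rewrite size_map size_iota.
pose W := [set w in s]; apply: leq_trans (_ : #|W| <= _); last by rewrite cardsE card_size.
apply: metric_dim_le; apply/resolvingP => v w nvw.
have mem_s i t : 0 < t <= N i -> coaxis i t \in W.
  move=> tN; rewrite inE; apply/flattenP.
  exists [seq coaxis i t | t <- iota 1 (N i)]; first by apply: map_f; rewrite mem_enum.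
  by apply: map_f; rewrite mem_iota; lia.
have sep (x y : V) i : lev x i < lev y i ->
    exists2 u, u \in W & gdist edge y u != gdist edge x u.
  move=> xy; have yN := lev_le y i; exists (coaxis i (lev y i)).
    by apply: mem_s; lia.
  have levu : forall k, lev (coaxis i (lev y i)) k = if k == i then N i - lev y i else N k.
    by apply: lev_coaxis; rewrite oth; lia.
  apply: annihilates_separates; last first.
    by apply/forallPn; exists i; rewrite levu eqxx; lia.
  by apply/forallP => k; rewrite levu; case: eqP => [->|_]; lia.
case: (boolP [exists i, lev v i != lev w i]) => [/existsP[i]|/existsPn eq_lev].
  rewrite neq_ltn => /orP[] /sep[u uW gu]; exists u => //.
  by rewrite eq_sym.
by case/eqP: nvw; apply: lev_inj => i; apply/eqP/negPn.
Qed.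

(** The vertex [e_i] does not annihilate [w]: if [w] vanishes at [i] and [j], index [j] fails; if
    [w] is full there, an index where [w] is below [N] fails. The distance is then 2 or 3 according
    to whether [i] is in the support of [w]. *)
Lemma gdist_axis1 w i j : i != j -> N i = 1 -> N j = 1 -> lev w i = lev w j ->
  gdist edge (axis i 1) w = 3 - lev w i.
Proof.
move=> nij Ni Nj ewij; have wi := lev_le w i; rewrite Ni in wi.
have oi : others i by apply/existsP; exists j; rewrite eq_sym.
have levi : forall k, lev (axis i 1) k = if k == i then 1 else 0.
  by apply: lev_axis; rewrite oi Ni.
have levij : lev (axis i 1) j = 0 by rewrite levi eq_sym (negPf nij).
rewrite gdist_exponent; have -> : (axis i 1 == w) = false.
  by apply/eqP => e; have := levi i; rewrite eqxx e ewij -e levij.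
have -> : annihilates (axis i 1) w = false.
  apply/negP => /forallP a; case: (posnP (lev w i)) => [w0|w1].
    by have := a j; rewrite levij Nj -ewij w0.
  have [k wk] := lev_ltN w; have := a k; rewrite levi.
  case: eqP => [ek|_]; last by move: wk; clear; lia.
  by move: wk w1; rewrite ek Ni; clear; lia.
rewrite /meets; case: existsP => [[k]|nm].
  by rewrite levi; case: eqP => // -> /andP[_]; move: wi; clear; lia.
case: (posnP (lev w i)) => [->//|w1]; case: nm; exists i.
by rewrite levi eqxx.
Qed.

Lemma axis_separates W i j : resolving edge W -> i != j -> N i = 1 -> N j = 1 ->
  exists2 w, w \in W & (lev w i == 0) != (lev w j == 0).
Proof.
move=> /resolvingP rW nij Ni Nj.
have oi : others i by apply/existsP; exists j; rewrite eq_sym.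
have [|w wW gw] := rW (axis i 1) (axis j 1).
  apply/eqP => e; have := @lev_axis i 1 _ i; have := @lev_axis j 1 _ i.
  have oj : others j by apply/existsP; exists i.
  by rewrite e oi oj Ni Nj eqxx (negPf nij) => -> // /(_ isT).
exists w => //; apply: contra_neqN gw => /eqP ew.
have wi := lev_le w i; have wj := lev_le w j; rewrite Ni in wi; rewrite Nj in wj.
have ewij : lev w i = lev w j by move: ew wi wj; clear; lia.
by rewrite (gdist_axis1 nij) // (@gdist_axis1 w j i) 1?eq_sym // ewij.
Qed.

Lemma metric_dim_ge_sum : (forall i j, exists k : I, (k != i) && (k != j)) ->
  \sum_i N i - #|I| + up_log 2 #|[set i | N i == 1]| <= metric_dim edge.
Proof.
move=> third; have oth i : others i.
  by have [k /andP[ki _]] := third i i; apply/existsP; exists k.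
apply: metric_dim_ge => W rW.
(* Vectors that are zero at all other indices or full at all other indices: these include both lines
   of [i]. *)
pose L i w := [forall j, (j != i) ==> (lev w j == 0)] ||
              [forall j, (j != i) ==> (lev w j == N j)].
(* The condition [1 < N i] keeps the lines of field factors out of [B], so that their points can
   serve for the logarithm. *)
pose A i := [set w in W | (1 < N i) && L i w]; pose B := \bigcup_i A i.
have LX i c : 0 < c <= N i -> L i (axis i c).
  move=> cN; apply/orP; left; apply/forallP => j; apply/implyP => /negPf nji.
  by rewrite lev_axis ?nji //; rewrite oth; lia.
have LY i t : 0 < t <= N i -> L i (coaxis i t).
  move=> tN; apply/orP; right; apply/forallP => j; apply/implyP => /negPf nji.
  by rewrite lev_coaxis ?nji //; rewrite oth; lia.
(* A vector zero off one index and full off the other contradicts a third index; otherwise all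
   coordinates are zero or all are full, which no vertex allows. *)
have Ldisj i j w : L i w -> L j w -> i = j.
  move=> Li Lj; apply/eqP/negPn/negP => nij; have [k /andP[ki kj]] := third i j.
  have Nk := N_gt0 k; case/orP: Li => /forallP wi; case/orP: Lj => /forallP wj.
  - have [l] := lev_gt0 w; have := wi l; have := wj l.
    by case: (l =P i) => [->|_ _ /= /eqP->//]; rewrite nij /= => /eqP ->.
  - by have := wi k; have := wj k; rewrite ki kj /= => /eqP-> /eqP; lia.
  - by have := wi k; have := wj k; rewrite ki kj /= => /eqP-> /eqP; lia.
  have [l] := lev_ltN w; have := wi l; have := wj l.
  case: (l =P i) => [->|_ _ /= /eqP->]; last by rewrite ltnn.
  by rewrite nij /= => /eqP ->; rewrite ltnn.
have sumB : \sum_i N i - #|I| <= #|B|.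
  have -> : #|B| = \sum_i #|A i|.
    rewrite -sum1_card partition_disjoint_bigcup.
      by apply: eq_bigr => i _; rewrite sum1_card.
    move=> i j nij; rewrite -setI_eq0; apply/eqP/setP => w; rewrite !inE.
    apply/negP => /andP[/and3P[_ _ Li] /and3P[_ _ /(Ldisj _ _ _ Li) eij]].
    by rewrite eij eqxx in nij.
  rewrite leq_subLR -sum1_card -big_split; apply: leq_sum => i _ /=.
  rewrite -leq_subLR; case: (ltnP 1 (N i)) => Ni; last by have := N_gt0 i; lia.
  apply: (line_card rW (oth i)) => [c cN cW|t t1 tN tW].
    by rewrite inE cW Ni LX.
  by rewrite inE tW Ni LY //; lia.
pose W' := W :\: B.
have BW : W :&: B = B.
  by apply/setIidPr/bigcupsP => i _; apply/subsetP => w; rewrite inE => /andP[].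
rewrite -(cardsID B W) BW leq_add //; apply: up_log_min => //.
(* Sending a field index to the set of points of [W'] vanishing there is injective, so there are at
   most [2 ^ #|W'|] field indices. *)
rewrite -/W' -card_powerset; pose phi i := [set w in W' | lev w i == 0].
have injphi : {in [set i | N i == 1] &, injective phi}.
  move=> i j; rewrite !inE => /eqP Ni /eqP Nj ephi; apply/eqP/negPn/negP => nij.
  have [w wW] := axis_separates rW nij Ni Nj.
  have wi := lev_le w i; have wj := lev_le w j; rewrite Ni in wi; rewrite Nj in wj.
  (* On the lines of a nonfield index [k], the coordinates at [i] and [j] are both 0 or both 1, so
     the separating [w] is not in [B]. *)
  move=> nw; have wW' : w \in W'.
    rewrite inE wW andbT; apply/bigcupP => -[k _]; rewrite inE wW /= => /andP[Nk].
    have ki : k != i by apply: contraTneq Nk => ->; rewrite Ni.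
    have kj : k != j by apply: contraTneq Nk => ->; rewrite Nj.
    case/orP=> /forallP kw; move: (kw i) (kw j) nw; rewrite !(eq_sym _ k) ki kj /=.
      by move=> /eqP-> /eqP->.
    by rewrite Ni Nj => /eqP-> /eqP->.
  by move/setP/(_ w): ephi; rewrite inE wW' inE wW' /=; move: nw; case: eqP; case: eqP.
rewrite -(card_in_imset injphi); apply: subset_leq_card; apply/subsetP => C.
case/imsetP => i _ ->; rewrite inE; apply/subsetP => w; rewrite inE; by case/andP.
Qed.

(** * Exact values for one and two factors *)

Lemma gdist_self_neq v w : v != w -> gdist edge v v != gdist edge w v.
Proof. by move=> nvw; rewrite gdistxx eq_sym gdist_eq0 eq_sym. Qed.

(** With a single index the two lines coincide, so a point of [W] is counted at most twice in
    [line_count]. Conversely the lowest [(N i - 1) %/ 2] points resolve the graph. *)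
Lemma metric_dim_one i : (forall k, k = i) -> metric_dim edge = (N i - 1) %/ 2.
Proof.
move=> only; have noti : others i = false.
  by apply/existsP => -[k]; rewrite (only k) eqxx.
apply/eqP; rewrite eqn_leq; apply/andP; split; last first.
  apply: metric_dim_ge => W rW.
  have lc : (N i).-1 < N i + others i by have := N_gt0 i; lia.
  have uX := uniq_axis lc; have uY := @uniq_coaxis i (N i) (leq_addr _ _).
  have := line_count rW lc.
  have := @count_mem_le_card _ _ W W uX (fun _ _ => id).
  have := @count_mem_le_card _ _ W W uY (fun _ _ => id).
  by clear; lia.
pose f := (N i - 1) %/ 2; pose s := [seq axis i c | c <- iota 1 f].
pose W := [set w in s]; apply: leq_trans (_ : #|W| <= _); last first.
  by rewrite cardsE (leq_trans (card_size _)) // size_map size_iota.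
apply: metric_dim_le; apply/resolvingP.
have levA c : 0 < c < N i -> lev (axis i c) i = c.
  by move=> cN; rewrite lev_axis ?eqxx // noti addn0.
have inW v : lev v i <= f -> v \in W.
  move=> vf; rewrite inE; apply/mapP; exists (lev v i).
    by rewrite mem_iota; have [k] := lev_gt0 v; rewrite (only k); lia.
  by rewrite /axis (@vertex_of_lev v) // => k; rewrite (only k) eqxx.
have sep v w : lev v i < lev w i ->
    exists2 u, u \in W & gdist edge v u != gdist edge w u.
  move=> vw; have nvw : v != w by apply: contraTneq vw => ->; rewrite ltnn.
  have [vf|fv] := leqP (lev v i) f.
    by exists v; [apply: inW | apply: gdist_self_neq].
  have wN : lev w i < N i by have [k] := lev_ltN w; rewrite (only k).
  have levu : lev (axis i (N i - lev w i)) i = N i - lev w i.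
    by apply: levA; have := N_gt0 i; lia.
  (* Here [lev w i >= f + 2], and [2 f + 2 >= N i], so [N i - lev w i] is at most [f]. *)
  exists (axis i (N i - lev w i)); first by apply: inW; rewrite levu /f; lia.
  rewrite eq_sym; apply: annihilates_separates.
    by apply/forallP => k; rewrite (only k) levu; lia.
  by apply/forallPn; exists i; rewrite levu; lia.
move=> v w nvw; have : lev v i != lev w i.
  by apply: contra nvw => /eqP e; apply/eqP/lev_inj => k; rewrite (only k).
by rewrite neq_ltn => /orP[/sep//|/sep[u uW gu]]; exists u; rewrite // eq_sym.
Qed.

Lemma annihilates_two i j v w : (forall k, (k == i) || (k == j)) ->
  annihilates v w = (N i <= lev v i + lev w i) && (N j <= lev v j + lev w j).
Proof.
move=> only; apply/forallP/andP => [a|[ai aj] k]; first by split; apply: a.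
by case/orP: (only k) => /eqP->.
Qed.

Lemma meets_two i j v w : (forall k, (k == i) || (k == j)) ->
  meets v w = (0 < lev v i) && (0 < lev w i) || (0 < lev v j) && (0 < lev w j).
Proof.
move=> only; apply/existsP/orP => [[k]|[]]; last 2 first.
- by exists i.
- by exists j.
by case/orP: (only k) => /eqP->; [left|right].
Qed.

Lemma meets_separates v w u : v != u -> w != u -> ~~ annihilates v u ->
  ~~ annihilates w u -> meets v u -> ~~ meets w u -> gdist edge v u != gdist edge w u.
Proof.
move=> /negPf nvu /negPf nwu /negPf avu /negPf awu mv /negPf mw.
by rewrite !gdist_exponent nvu nwu avu awu mv mw.
Qed.

(** Some [w] separates the neighbours [(t, b)] and [(t + 1, b)] for [t = N i - s - 1]. If [lev w j]
    is positive, both meet [w], so annihilation changes between them and [lev w i = s]. If it is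
    zero, neither annihilates [w], so the support changes and [t = 0]. *)
Lemma threshold_in_free_row W i j b s :
  i != j -> (forall k, (k == i) || (k == j)) -> resolving edge W ->
  0 < b < N j -> (forall w, w \in W -> lev w j != b) -> 0 < s < N i ->
  exists2 w, w \in W & if lev w j == 0 then s = (N i).-1 else lev w i = s.
Proof.
move=> nij only /resolvingP rW bN free sN.
have levV t : t <= N i -> exists v, lev v i = t /\ lev v j = b.
  move=> tN; have [k|||v levv] := @lev_onto (fun k => if k == i then t else b).
  - by case: eqP => [->//|]; case/orP: (only k) => /eqP -> //; lia.
  - by exists j; rewrite eq_sym (negPf nij); lia.
  - by exists j; rewrite eq_sym (negPf nij); lia.
  by exists v; rewrite !levv eqxx eq_sym (negPf nij).
pose t := N i - s.+1.
have [v [vi vj]] : exists v, lev v i = t /\ lev v j = b by apply: levV; apply: leq_subr.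
have [v' [v'i v'j]] : exists v, lev v i = t.+1 /\ lev v j = b.
  by apply: levV; rewrite /t; lia.
have [|w wW] := rW v v'.
  by apply/eqP => evv; move: v'i; rewrite -evv vi; clear; lia.
have nb := free w wW; rewrite !gdist_exponent.
rewrite !(annihilates_two _ _ only) !(meets_two _ _ only) vi vj v'i v'j.
have -> : (v == w) = false by apply: contraNF nb => /eqP <-; rewrite vj.
have -> : (v' == w) = false by apply: contraNF nb => /eqP <-; rewrite v'j.
move=> sep; exists w => //; move: sep; have := lev_le w j.
rewrite /t; have [->|wj0] := posnP (lev w j).
  rewrite addn0 (leqNgt (N j)) (_ : b < N j); last by case/andP: bN.
  rewrite !andbF !orbF => _; move: sN; clear.
  by case: (0 < lev w i); rewrite ?andbF ?andbT //=; case: ifP => //; lia.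
have b0 : 0 < b by case/andP: bN.
rewrite b0 !orbT; case: (N j <= _); rewrite ?andbF // !andbT.
by move: sN (lev_le w i); clear; case: ifP; case: ifP; lia.
Qed.

Ltac natlia := repeat match goal with
  | H : context [in_mem _ _] |- _ => clear H
  | H : context [resolving _ _] |- _ => clear H
  | H : forall _, _ |- _ => clear H
  end; lia.

(** A set [S] splits [W] so that each side pays for one index. The implication settles the double
    role of [axis i (N i)], which is also [coaxis j (N j)]; it holds for at least one order of [i]
    and [j]. *)
Lemma card_resolving_two W i j :
  i != j -> (forall k, (k == i) || (k == j)) -> resolving edge W ->
  (axis i (N i) \in W -> axis j (N j) \in W) -> N i + N j - 2 <= #|W|.
Proof.
move=> nij only rW PQ; have nji : j != i by rewrite eq_sym.
have oi : others i by apply/existsP; exists j.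
have oj : others j by apply/existsP; exists i.
have levX k l c : 0 < c <= N k -> others k -> lev (axis k c) l = if l == k then c else 0.
  by move=> cN ok; apply: lev_axis; rewrite ok; natlia.
have levY k l c : 0 < c <= N k -> others k ->
    lev (coaxis k c) l = if l == k then N k - c else N l.
  by move=> cN ok; apply: lev_coaxis; rewrite ok; natlia.
suff [S leI leJ] : exists2 S : {set V}, N j - 1 <= #|W :&: S| & N i - 1 <= #|W :\: S|.
  by rewrite -(cardsID S W); have := N_gt0 i; have := N_gt0 j; natlia.
case: (boolP [forall b : 'I_(N j), (0 < b) ==> [exists w in W, lev w j == b]]) => hit.
  (* Each row strictly between 0 and [N j] contributes a point of [S], while both lines of [i] lie
     in the rows 0 and [N j]. *)
  exists [set w | 0 < lev w j < N j].
    rewrite -[_ - 1](size_iota 1); apply: (@size_le_card _ _ (lev^~ j) _ _ (iota_uniq _ _)).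
    move=> b; rewrite mem_iota => bN; have ltb : b < N j by natlia.
    have /existsP[w /andP[wW /eqP wb]] 
      := implyP (forallP hit (Ordinal ltb)) ltac:(simpl; natlia).
    by exists w; rewrite // !inE wW wb /=; natlia.
  apply: (line_card rW oi) => [c cN|t t1 tN] inW; rewrite !inE inW andbT.
    by rewrite levX // (negPf nji).
  by rewrite levY ?(negPf nji) ?ltnn ?andbF //; lia.
have /forallPn[b] := hit; rewrite negb_imply => /andP[b0 /existsPn free].
(* The columns 0 and [N i] above row 0 contain the lines of [j] except for [axis i (N i)]; the
   points outside [S] supply the thresholds forced by the free row [b]. *)
exists [set w | (0 < lev w j) && ((lev w i == 0) || (lev w i == N i))].
  apply: (line_card rW oj) => [c cN|t t1 tN] inW; rewrite !inE inW /=.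
    by rewrite !levX // eqxx (negPf nij); case/andP: cN => ->.
  have tNj : 0 < t <= N j by move: t1 tN; clear; lia.
  rewrite !(levY _ _ _ tNj oj) eqxx (negPf nij) eqxx orbT andbT subn_gt0.
  rewrite ltn_neqAle (andP tNj).2 andbT.
  (* For [t = N j] the point is [axis i (N i)]. If it is in [W], so is [axis j (N j)], and then
     [line_card] excuses this [t]. *)
  apply/eqP => etN; move: tN PQ; rewrite etN; case: (axis j _ \in W).
    by rewrite addn1 ltnn.
  move=> _; suff -> : axis i (N i) = coaxis j (N j) by rewrite -{1}etN inW => /(_ isT).
  have Nj0 := N_gt0 j; have Ni0 := N_gt0 i.
  apply: lev_inj => k; rewrite levX ?levY ?subnn ?leqnn ?andbT //.
  by case/orP: (only k) => /eqP->; rewrite eqxx ?(negPf nij) ?(negPf nji).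
rewrite -[_ - 1](size_iota 1).
(* [g] labels a point with the one threshold it can serve; in row 0 this is [N i - 1]. *)
pose g w := if lev w j == 0 then (N i).-1 else lev w i.
apply: (@size_le_card _ _ g _ _ (iota_uniq _ _)) => s; rewrite mem_iota => sN.
have [|w wW||w wW ws] := @threshold_in_free_row W i j b s nij only rW.
- by rewrite b0 ltn_ord.
- by have := free w; rewrite wW.
- by natlia.
exists w; last by rewrite /g; case: (lev w j == 0) ws.
rewrite !inE wW andbT lt0n; case: (lev w j == 0) ws => //= ->.
by rewrite negb_or; natlia.
Qed.

(** The ends [(0, N j)] and [(N i, 0)] are the thresholds [t = N i] and [t = N j]; by telling
    distance 2 from 3 they also replace the thresholds [t = 1]. *)
Lemma metric_dim_le_two i j :
  i != j -> (forall k, (k == i) || (k == j)) -> N j <= N i ->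
  metric_dim edge <= N i + N j - 2 + ((N i == 1) && (N j == 1)).
Proof.
move=> nij only ltji; have nji : j != i by rewrite eq_sym.
have oi : others i by apply/existsP; exists j.
have oj : others j by apply/existsP; exists i.
have Nj0 := N_gt0 j; have Ni0 := N_gt0 i.
have levX k l c : 0 < c <= N k -> others k -> lev (axis k c) l = if l == k then c else 0.
  by move=> cN ok; apply: lev_axis; rewrite ok; natlia.
have levY k l c : 0 < c <= N k -> others k ->
    lev (coaxis k c) l = if l == k then N k - c else N l.
  by move=> cN ok; apply: lev_coaxis; rewrite ok; natlia.
(* For [N j = 1] only the end [axis j (N j)] is taken, which keeps the size at [N i - 1], or at 1
   for two fields. *)
pose s := axis j (N j) :: nseq (1 < N j) (axis i (N i)) ++
  [seq coaxis i t | t <- iota 2 (N i - 2)] ++ [seq coaxis j t | t <- iota 2 (N j - 2)].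
pose W := [set w in s]; apply: leq_trans (_ : #|W| <= _); last first.
  rewrite cardsE; apply: leq_trans (card_size _) _.
  rewrite /= !size_cat !size_map !size_iota size_nseq.
  by move: Nj0 Ni0 ltji; clear; case: ltnP; case: eqP; case: eqP => /=; natlia.
have PW : axis j (N j) \in W by rewrite !inE eqxx.
have QW : 1 < N j -> axis i (N i) \in W.
  by move=> Nj1; rewrite inE in_cons mem_cat mem_nseq Nj1 eqxx orbT.
have YW k t : 1 < t < N k -> coaxis k t \in W.
  move=> tN; rewrite inE in_cons !mem_cat.
  by case/orP: (only k) tN => /eqP -> tN;
    rewrite (map_f (coaxis _)) ?orbT // mem_iota; move: tN; natlia.
apply: metric_dim_le; apply/resolvingP => v w nvw.
have sepY k x y : lev x k < lev y k -> 1 < lev y k < N k ->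
    exists2 u, u \in W & gdist edge x u != gdist edge y u.
  move=> xy yN; exists (coaxis k (lev y k)); first exact: YW.
  have levu l : lev (coaxis k (lev y k)) l = if l == k then N k - lev y k else N l.
    by apply: levY; [natlia | case/orP: (only k) => /eqP->].
  rewrite eq_sym; apply: annihilates_separates.
    by apply/forallP => l; rewrite levu; case: eqP => [->|_]; natlia.
  by apply/forallPn; exists k; rewrite levu eqxx; natlia.
have levP : lev (axis j (N j)) i = 0 /\ lev (axis j (N j)) j = N j.
  by rewrite !levX ?Nj0 ?leqnn // eqxx (negPf nij).
have levQ : lev (axis i (N i)) i = N i /\ lev (axis i (N i)) j = 0.
  by rewrite !levX ?Ni0 ?leqnn // eqxx (negPf nji).
have eqV x y : lev x i = lev y i -> lev x j = lev y j -> x = y.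
  by move=> ei ej; apply: lev_inj => k; case/orP: (only k) => /eqP->.
have nz x : (0 < lev x i) || (0 < lev x j).
  by have [k xk] := lev_gt0 x; case/orP: (only k) xk => /eqP-> ->; rewrite ?orbT.
have nN x : (lev x i < N i) || (lev x j < N j).
  by have [k xk] := lev_ltN x; case/orP: (only k) xk => /eqP-> ->; rewrite ?orbT.
case: (boolP (v \in W)) => [vW|nvW]; first by exists v => //; apply: gdist_self_neq.
case: (boolP (w \in W)) => [wW|nwW].
  by exists w => //; rewrite eq_sym; apply: gdist_self_neq; rewrite eq_sym.
have nP x : x \notin W -> x != axis j (N j) by apply: contraNneq => ->.
have nQ x : 1 < N j -> x \notin W -> x != axis i (N i).
  by move=> Nj1; apply: contraNneq => ->; apply: QW.
have sepi x y : x \notin W -> y \notin W -> lev x i < lev y i ->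
    exists2 u, u \in W & gdist edge x u != gdist edge y u.
  move=> nxW nyW xy; have [y1|y1] := leqP (lev y i) 1; last first.
    have [yN|yN] := ltnP (lev y i) (N i); first by apply: (sepY _ _ _ xy); rewrite y1.
    exists (axis j (N j)) => //; rewrite eq_sym; apply: annihilates_separates;
      rewrite (annihilates_two _ _ only) levP.1 levP.2.
      by rewrite addn0 yN leq_addl.
    by rewrite addn0 leqNgt (leq_trans xy) ?lev_le.
  (* The missing threshold 1: [axis i (N i)] either is annihilated by [y] alone or meets [y]
     alone. *)
  have x0i : lev x i = 0 by natlia.
  have yi : lev y i = 1 by natlia.
  have xjN : lev x j < N j.
    rewrite ltn_neqAle lev_le andbT; apply: contra (nP x nxW) => /eqP xj.
    by apply/eqP/eqV; rewrite ?levP.1 ?levP.2.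
  have Nj1 : 1 < N j by have := nz x; rewrite x0i; natlia.
  exists (axis i (N i)); first exact: QW.
  have nax : ~~ annihilates x (axis i (N i)).
    by rewrite (annihilates_two _ _ only) levQ.1 levQ.2; natlia.
  have [yjN|yjN] := ltnP (lev y j) (N j).
    rewrite eq_sym; apply: meets_separates; rewrite ?nQ //;
    by rewrite ?(annihilates_two _ _ only) ?(meets_two _ _ only) levQ.1 levQ.2; natlia.
  rewrite eq_sym; apply: annihilates_separates => //.
  by rewrite (annihilates_two _ _ only) levQ.1 levQ.2; natlia.
have sepj x y : x \notin W -> y \notin W -> lev x i = lev y i -> lev x j < lev y j ->
    exists2 u, u \in W & gdist edge x u != gdist edge y u.
  move=> nxW nyW eqi xy; have [/andP[y1 yN]|] := boolP (1 < lev y j < N j).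
    by apply: (sepY _ _ _ xy); rewrite y1.
  (* What remains is [lev y j = 1] or [lev y j = N j]. *)
  rewrite negb_and -leqNgt -leqNgt => nyj.
  have sepP : lev x j = 0 -> lev x i < N i ->
      exists2 u, u \in W & gdist edge x u != gdist edge y u.
    move=> xj0 xiN; exists (axis j (N j)) => //; rewrite eq_sym.
    apply: meets_separates; rewrite ?nP //;
    by rewrite ?(annihilates_two _ _ only) ?(meets_two _ _ only) levP.1 levP.2; natlia.
  have [yjN|yjN] := ltnP (lev y j) (N j).
    have xj0 : lev x j = 0 by natlia.
    apply: sepP => //; rewrite ltn_neqAle lev_le andbT.
    apply: contra (nQ x _ nxW) => [/eqP xi|]; last by natlia.
    by apply/eqP/eqV; rewrite ?levQ.1 ?levQ.2.
  have yiN : lev y i < N i by have := nN y; natlia.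
  have [Nj1|Nj1] := leqP (N j) 1; first by apply: sepP; have := lev_le y j; natlia.
  exists (axis i (N i)); first exact: QW.
  rewrite eq_sym; apply: annihilates_separates;
  by rewrite (annihilates_two _ _ only) levQ.1 levQ.2; have := lev_le y j; natlia.
case: (ltngtP (lev v i) (lev w i)) => [vw|wv|eqi]; first exact: sepi.
  by have [u uW gu] := sepi _ _ nwW nvW wv; exists u; rewrite // eq_sym.
case: (ltngtP (lev v j) (lev w j)) => [vw|wv|eqj]; first exact: sepj.
  by have [u uW gu] := sepj _ _ nwW nvW (esym eqi) wv; exists u; rewrite // eq_sym.
by case/eqP: nvw; apply: eqV.
Qed.

Lemma metric_dim_two i j : i != j -> (forall k, (k == i) || (k == j)) ->
  metric_dim edge = N i + N j - 2 + ((N i == 1) && (N j == 1)).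
Proof.
move=> nij only; have nji : j != i by rewrite eq_sym.
have only' k : (k == j) || (k == i) by rewrite orbC.
apply/eqP; rewrite eqn_leq; apply/andP; split.
  have [ji|ij] := leqP (N j) (N i); first exact: metric_dim_le_two.
  by rewrite (addnC (N i)) andbC; apply: metric_dim_le_two; rewrite // ltnW.
apply: metric_dim_ge => W rW.
case: (boolP ((N i == 1) && (N j == 1))) => [/andP[/eqP Ni /eqP Nj]|_].
  rewrite Ni Nj /=; have [w wW _] := axis_separates rW nij Ni Nj.
  by apply/card_gt0P; exists w.
rewrite addn0; case: (boolP (axis i (N i) \in W)) => iW; last first.
  by apply: (card_resolving_two _ only rW) => //; move/negP: iW.
case: (boolP (axis j (N j) \in W)) => jW; first exact: (card_resolving_two nij only rW).
by rewrite (addnC (N i)); apply: (card_resolving_two _ only' rW) => //; move/negP: jW.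
Qed.

End ExponentGraph.
(** * Finite local principal rings *)

Import GRing.Theory.
Local Open Scope ring_scope.

Section PrincipalIdeals.

Variable R : finComNzRingType.
Implicit Types (x y a b : R) (I A : {set R}).

Definition principal a : {set R} := [set x | [exists r, x == r * a]].

Lemma principalP a x : reflect (exists r, x = r * a) (x \in principal a).
Proof.
rewrite inE; apply: (iffP existsP) => -[r]; first by move/eqP; exists r.
by move=> ->; exists r.
Qed.

Lemma mem_principal a : a \in principal a.
Proof. by apply/principalP; exists 1; rewrite mul1r. Qed.

Lemma is_idealP I :
  reflect (0 \in I /\ forall a x y, x \in I -> y \in I -> a * x + y \in I) (is_ideal I).
Proof.
apply: (iffP andP) => -[I0 cl]; split=> //.
  by move=> a x y xI yI; have /forallP/(_ a)/forall_inP/(_ x xI)/forall_inP/(_ y yI) := cl.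
apply/forallP => a; apply/forall_inP => x xI; apply/forall_inP => y yI; exact: cl.
Qed.

Lemma idealM I a x : is_ideal I -> x \in I -> a * x \in I.
Proof. by move=> /is_idealP[I0 cl] xI; rewrite -[_ * _]addr0 cl. Qed.

Lemma principal_is_ideal a : is_ideal (principal a).
Proof.
apply/is_idealP; split=> [|b x y /principalP[r ->] /principalP[s ->]].
  by apply/principalP; exists 0; rewrite mul0r.
by apply/principalP; exists (b * r + s); rewrite mulrDl mulrA.
Qed.

Lemma principal_sub I a : is_ideal I -> (principal a \subset I) = (a \in I).
Proof.
move=> idI; apply/idP/idP => [/subsetP->|aI]; first by [].
  exact: mem_principal.
by apply/subsetP => x /principalP[r ->]; apply: idealM.
Qed.

Lemma ideal_gen_sub I A : is_ideal I -> A \subset I -> ideal_gen A \subset I.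
Proof. by move=> idI AI; apply: bigcap_inf; rewrite idI. Qed.

Lemma sub_ideal_gen A : A \subset ideal_gen A.
Proof. by apply/bigcapsP => I /andP[]. Qed.

Lemma ideal_gen_is_ideal A : is_ideal (ideal_gen A).
Proof.
apply/is_idealP; split=> [|a x y /bigcapP xA /bigcapP yA].
  by apply/bigcapP => I /andP[/is_idealP[]].
apply/bigcapP => I PI; have /andP[/is_idealP[_ cl] _] := PI.
by apply: cl; [apply: xA | apply: yA].
Qed.

Lemma ideal_gen1 a : ideal_gen [set a] = principal a.
Proof.
apply/eqP; rewrite eqEsubset ideal_gen_sub ?principal_is_ideal ?sub1set ?mem_principal //=.
by rewrite principal_sub ?ideal_gen_is_ideal // -sub1set sub_ideal_gen.
Qed.

Lemma ideal_mul_principal a b : ideal_mul (principal a) (principal b) = principal (a * b).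
Proof.
apply/eqP; rewrite eqEsubset ideal_gen_sub ?principal_is_ideal //=; last first.
  apply/subsetP => _ /imset2P[_ _ /principalP[r ->] /principalP[s ->] ->].
  by apply/principalP; exists (r * s); rewrite mulrACA.
rewrite principal_sub ?ideal_gen_is_ideal //; apply: (subsetP (sub_ideal_gen _)).
by apply: imset2_f; apply: mem_principal.
Qed.

Lemma principal1 : principal 1 = [set: R].
Proof. by apply/setP => x; rewrite [RHS]inE; apply/principalP; exists x; rewrite mulr1. Qed.

Lemma principal0 : principal 0 = [set 0].
Proof.
apply/setP => x; rewrite [RHS]inE; apply/principalP/eqP => [[r ->]|->]; first exact: mulr0.
by exists 0; rewrite mulr0.
Qed.

Lemma principal_eq0 a : (principal a == [set 0]) = (a == 0).
Proof.
apply/eqP/eqP => [e|->]; last exact: principal0.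
by have := mem_principal a; rewrite e inE => /eqP.
Qed.

Lemma ideal_exp_principal a k : ideal_exp (principal a) k = principal (a ^+ k).
Proof.
elim: k => [|k IHk]; first by rewrite principal1.
by rewrite /ideal_exp iterS -/(ideal_exp _ _) IHk ideal_mul_principal exprS.
Qed.

Lemma principal_ring_gen I : principal_ring R -> is_ideal I -> exists a, I = principal a.
Proof. by move=> pR /pR[a ->]; exists a; rewrite ideal_gen1. Qed.

Lemma ideal_proper I : is_ideal I -> (I != setT) = (1 \notin I).
Proof.
move=> idI; congr (~~ _); apply/eqP/idP => [->|I1]; first by rewrite inE.
by apply/setP => x; rewrite inE -[x]mulr1 idealM.
Qed.

Lemma jacobson_local M :
  maximal_ideal M -> (forall M', maximal_ideal M' -> M = M') -> jacobson R = M.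
Proof.
move=> maxM uniqM; apply/eqP; rewrite eqEsubset; apply/andP; split.
  exact: bigcap_inf.
by apply/bigcapsP => M' /uniqM ->.
Qed.

(** [p] generates the maximal ideal and [m] is its nilpotency order; the last clause makes the ring
    local. For a field, [p = 0] and [m = 1]. *)
Definition uniformizer (p : R) (m : nat) : Prop :=
  [/\ (0 < m)%N, p ^+ m = 0, p ^+ m.-1 != 0 &
      forall x, (exists y, x * y = 1) \/ (exists y, x = y * p)].

Lemma uniformizer_factor p m x : uniformizer p m ->
  exists u v k, [/\ u * v = 1, (k <= m)%N & x = u * p ^+ k].
Proof.
case=> m0 pm _ unit_or.
have step j : (j <= m)%N -> (exists u v k, [/\ u * v = 1, (k <= m)%N & x = u * p ^+ k]) \/
    exists y, x = y * p ^+ j.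
  elim: j => [|j IHj] ltjm; first by right; exists x; rewrite mulr1.
  case: (IHj (ltnW ltjm)) => [|[y xE]]; first by left.
  case: (unit_or y) => [[v uv]|[z yE]].
    by left; exists y, v, j; split=> //; apply: ltnW.
  by right; exists z; rewrite xE yE exprS mulrA.
(* An element divisible by [p ^+ m] is zero and is written with the unit 1 and [k = m]. *)
case: (step m (leqnn m)) => // -[y xE]; exists 1, 1, m; split; rewrite ?mulr1 ?mul1r //.
by rewrite xE pm mulr0.
Qed.

Lemma uniformizer_expr_eq0 p m k : uniformizer p m -> (p ^+ k == 0) = (m <= k)%N.
Proof.
case=> m0 pm pm1 _; apply/eqP/idP => [pk|mk].
  rewrite leqNgt; apply: contra pm1 => km.
  have km1 : (k <= m.-1)%N by lia.
  by rewrite -(subnKC km1) exprD pk mul0r.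
by rewrite -(subnKC mk) exprD pm mul0r.
Qed.

(** If [a < b], multiplying by [p ^+ (m.-1 - a)] would make [p ^+ m.-1] a multiple of
    [p ^+ m = 0]. *)
Lemma uniformizer_dvd p m (a b : nat) r : uniformizer p m -> (b <= m)%N -> 
  p ^+ a = r * p ^+ b -> (b <= a)%N.
Proof.
move=> up bm e; rewrite leqNgt; apply/negP => ab; have [m0 _ /eqP[]] := up.
have am : (a <= m.-1)%N by lia.
have -> : p ^+ m.-1 = r * p ^+ (b + (m.-1 - a)).
  by rewrite exprD mulrA -e -exprD subnKC.
by apply/eqP; rewrite (_ : _ ^+ (b + _) = 0) ?mulr0 //; apply/eqP; 
  rewrite (uniformizer_expr_eq0 _ up); lia.
Qed.

Lemma uniformizer_proper p m y : uniformizer p m -> y * p <> 1.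
Proof.
move=> [m0 pm _ _] yp; have := congr1 (fun z => z ^+ m) yp.
by rewrite /= exprMn pm mulr0 expr1n => /esym/eqP; rewrite oner_eq0.
Qed.

Lemma uniformizer_sub p m I : uniformizer p m -> is_ideal I -> I != setT ->
  I \subset principal p.
Proof.
move=> [_ _ _ unit_or] idI; rewrite ideal_proper // => nI.
apply/subsetP => x xI; apply/principalP; case: (unit_or x) => // -[y xy].
by case/negP: nI; rewrite -xy mulrC idealM.
Qed.

Lemma uniformizer_maximal p m : uniformizer p m -> maximal_ideal (principal p).
Proof.
move=> up; apply/maxsetP; split.
  rewrite principal_is_ideal ideal_proper ?principal_is_ideal //.
  by apply/principalP => -[y /esym]; apply: uniformizer_proper up.
move=> I /andP[idI nI] pI; apply/eqP; rewrite eqEsubset pI andbT.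
exact: uniformizer_sub up _ _.
Qed.

Lemma uniformizer_maximal_unique p m I :
  uniformizer p m -> maximal_ideal I -> principal p = I.
Proof.
move=> up /maxsetP[/andP[idI nI] maxI]; apply: maxI.
  by have /maxsetP[] := uniformizer_maximal up.
exact: uniformizer_sub up _ _.
Qed.

Lemma uniformizer_jacobson p m : uniformizer p m -> jacobson R = principal p.
Proof.
move=> up; apply: jacobson_local; first exact: uniformizer_maximal up.
by move=> M; apply: uniformizer_maximal_unique up.
Qed.

Lemma uniformizer_local p m : uniformizer p m -> local_ring R.
Proof.
move=> up; exists (principal p); split; first exact: uniformizer_maximal up.
by move=> M; apply: uniformizer_maximal_unique up.
Qed.

Lemma uniformizer_nilpotency p m : uniformizer p m -> nilpotency_order (jacobson R) m.
Proof.
move=> up; rewrite (uniformizer_jacobson up); case: up => m0 pm pm1 _.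
split; rewrite // ideal_exp_principal ?pm ?principal0 //.
by apply/eqP; rewrite principal_eq0.
Qed.

Lemma uniformizer_chain p m : uniformizer p m -> chain_ring R.
Proof.
move=> up I J idI idJ; case: (boolP (I \subset J)) => [|/subsetPn[x xI nxJ]]; first by left.
right; apply/subsetP => y yJ.
have [u [v [k [uv _ xE]]]] := uniformizer_factor x up.
have [u' [v' [l [uv' _ yE]]]] := uniformizer_factor y up.
have [kl|lk] := leqP k l.
  suff -> : y = (u' * p ^+ (l - k) * v) * x by apply: idealM.
  by rewrite xE mulrA -(mulrA _ v u) (mulrC v) uv mulr1 -mulrA -exprD subnK.
case/negP: nxJ; suff -> : x = (u * p ^+ (k - l) * v') * y by apply: idealM.
by rewrite yE mulrA -(mulrA _ v' u') (mulrC v') uv' mulr1 -mulrA -exprD subnK // ltnW.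
Qed.

Lemma uniformizer_is_field p m : uniformizer p m -> is_field R = (m == 1)%N.
Proof.
move=> up; apply/forallP/eqP => [fR|m1 x].
  have p0 : p == 0.
    apply: contraT => np; have /existsP[y /eqP py] := implyP (fR p) np.
    by case: (uniformizer_proper up (y := y)); rewrite mulrC.
  have [m0 _ pm _] := up; apply/eqP; rewrite eqn_leq m0 andbT leqNgt.
  by apply: contra pm => m1; rewrite (eqP p0) expr0n; case: m m1 {up m0} => [|[|]].
apply/implyP => nx; have [_ pm _ unit_or] := up; rewrite m1 expr1 in pm.
case: (unit_or x) => -[y xE]; first by apply/existsP; exists y; apply/eqP.
by rewrite xE pm mulr0 eqxx in nx.
Qed.

Lemma exists_uniformizer m : local_ring R -> chain_ring R ->
  nilpotency_order (jacobson R) m -> exists p, uniformizer p m.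
Proof.
move=> [M [maxM uniqM]] chR; rewrite (jacobson_local maxM uniqM) => -[m0 Mm Mm1].
have /maxsetP[/andP[idM nM] _] := maxM; have [M0 _] := is_idealP _ idM.
(* In a chain ring, an element of [M] whose principal ideal is largest generates [M]. *)
have [p pM pmax] := @arg_maxnP _ 0 (mem M) (fun x => #|principal x|) M0.
have defM : M = principal p.
  apply/eqP; rewrite eqEsubset principal_sub // [p \in M]pM andbT; apply/subsetP => x xM.
  have [] := chR _ _ (principal_is_ideal x) (principal_is_ideal p).
    by move/subsetP; apply; apply: mem_principal.
  move=> px; have /eqP -> : principal p == principal x; last exact: mem_principal.
  by rewrite eqEcard px; apply: pmax.
exists p; move: Mm Mm1; rewrite defM !ideal_exp_principal => /eqP.
rewrite principal_eq0 => /eqP pm /eqP; rewrite principal_eq0 => pm1.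
split=> // x; case: (boolP (principal x == setT)) => [/eqP xT|nx].
  have := in_setT (1 : R); rewrite -xT => /principalP[y ->].
  by left; exists y; rewrite mulrC.
have [|M' maxM' xM'] := @maxset_exists _ (fun I => is_ideal I && (I != setT)) (principal x).
  by rewrite principal_is_ideal.
right; apply/principalP; rewrite -defM (uniqM _ maxM').
by apply: (subsetP xM'); apply: mem_principal.
Qed.

End PrincipalIdeals.
(** * Decomposition by primitive idempotents *)

Section CornerRing.

Variables (R : finComNzRingType) (e : R).
Hypotheses (idem : e * e = e) (e_neq0 : e != 0).

(* The ring eR, whose unit is e. *)
Definition corner of (e * e = e) & (e != 0) : Type := {x : R | x * e == x}.
Local Notation C := (corner idem e_neq0).

HB.instance Definition _ := SubFinite.copy C {x : R | x * e == x}.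

Fact corner_subproof (x : R) : (x * e) * e == x * e.
Proof. by rewrite -mulrA idem. Qed.

Definition to_corner (x : R) : C := exist _ (x * e) (corner_subproof x).

Lemma val_to_corner x : val (to_corner x) = x * e. Proof. by []. Qed.

Lemma corner_fix (x : C) : val x * e = val x.
Proof. by apply/eqP; case: x. Qed.

Definition corner_add (x y : C) := to_corner (val x + val y).
Definition corner_opp (x : C) := to_corner (- val x).
Definition corner_mul (x y : C) := to_corner (val x * val y).

Lemma val_corner_add x y : val (corner_add x y) = val x + val y.
Proof. by rewrite val_to_corner mulrDl !corner_fix. Qed.
Lemma val_corner_opp x : val (corner_opp x) = - val x.
Proof. by rewrite val_to_corner mulNr corner_fix. Qed.
Lemma val_corner_mul x y : val (corner_mul x y) = val x * val y.
Proof. by rewrite val_to_corner -mulrA corner_fix. Qed.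

Fact corner_addA : associative corner_add.
Proof. by move=> x y z; apply: val_inj; rewrite !val_corner_add addrA. Qed.
Fact corner_addC : commutative corner_add.
Proof. by move=> x y; apply: val_inj; rewrite !val_corner_add addrC. Qed.
Fact corner_add0 : left_id (to_corner 0) corner_add.
Proof. by move=> x; apply: val_inj; rewrite val_corner_add val_to_corner mul0r add0r. Qed.
Fact corner_addN : left_inverse (to_corner 0) corner_opp corner_add.
Proof.
by move=> x; apply: val_inj; rewrite val_corner_add val_corner_opp val_to_corner mul0r addNr.
Qed.
Fact corner_mulA : associative corner_mul.
Proof. by move=> x y z; apply: val_inj; rewrite !val_corner_mul mulrA. Qed.
Fact corner_mulC : commutative corner_mul.
Proof. by move=> x y; apply: val_inj; rewrite !val_corner_mul mulrC. Qed.
Fact corner_mul1 : left_id (to_corner 1) corner_mul.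
Proof.
by move=> x; apply: val_inj; rewrite val_corner_mul val_to_corner mul1r mulrC corner_fix.
Qed.
Fact corner_mulD : left_distributive corner_mul corner_add.
Proof.
move=> x y z; apply: val_inj.
by rewrite !(val_corner_mul, val_corner_add) mulrDl.
Qed.
Fact corner_oner_neq0 : to_corner 1 != to_corner 0.
Proof. by rewrite -val_eqE /= mul0r mul1r. Qed.

HB.instance Definition _ :=
  GRing.isZmodule.Build C corner_addA corner_addC corner_add0 corner_addN.
HB.instance Definition _ := GRing.Zmodule_isComNzRing.Build C
  corner_mulA corner_mulC corner_mul1 corner_mulD corner_oner_neq0.

Definition corner_ring : finComNzRingType := C.

Lemma val_cornerD (x y : corner_ring) : val (x + y) = val x + val y.
Proof. exact: val_corner_add. Qed.
Lemma val_cornerM (x y : corner_ring) : val (x * y) = val x * val y.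
Proof. exact: val_corner_mul. Qed.
Lemma val_corner0 : val (0 : corner_ring) = 0. Proof. exact: mul0r. Qed.
Lemma val_corner1 : val (1 : corner_ring) = e. Proof. exact: mul1r. Qed.

(** An ideal of [eR] is also an ideal of [R], where [a] acts as [a * e]; its generator in [R] lies
    in [eR]. *)
Lemma corner_principal : principal_ring R -> forall I : {set corner_ring},
  is_ideal I -> exists a, I = principal a.
Proof.
move=> pR I /is_idealP[I0 cl].
have [|g defI] := @principal_ring_gen _ [set val x | x in I] pR.
  apply/is_idealP; split; first by apply/imsetP; exists 0; rewrite ?val_corner0.
  move=> a _ _ /imsetP[x xI ->] /imsetP[y yI ->].
  apply/imsetP; exists ((to_corner a : corner_ring) * x + y); first exact: cl.
  by rewrite val_cornerD val_cornerM val_to_corner -mulrA (mulrC e) corner_fix.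
have /imsetP[h hI gh] : g \in [set val x | x in I] by rewrite defI mem_principal.
exists h; apply/eqP; rewrite eqEsubset; apply/andP; split.
  apply/subsetP => x xI; have : val x \in principal g by rewrite -defI imset_f.
  case/principalP => r xr; apply/principalP; exists (to_corner r); apply: val_inj.
  by rewrite xr val_cornerM val_to_corner -mulrA (mulrC e) corner_fix -gh.
rewrite principal_sub //; apply/is_idealP; split=> //.
Qed.

End CornerRing.

(** * Primitive idempotents *)

Section PrimitiveIdempotents.

Variable R : finComNzRingType.

(** The powers of [x] have period [b - a] from exponent [a] on; a positive multiple of the period
    that is at least [a] works. *)
Lemma exists_idempotent_power (x : R) : exists k, (0 < k)%N /\ x ^+ k * x ^+ k = x ^+ k.
Proof.
have [a [b [ab xab]]] : exists a b : nat, (a < b)%N /\ x ^+ a = x ^+ b.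
  have /injectivePn[i [j nij eij]] : ~~ injectiveb (fun i : 'I_#|R|.+1 => x ^+ i).
    by apply/injectiveP => /leq_card; rewrite card_ord ltnn.
  case: (ltngtP i j) => [ij|ji|/val_inj/eqP]; last by rewrite (negPf nij).
    by exists i, j.
  by exists j, i.
have per t k : (a <= k)%N -> x ^+ (k + t * (b - a)) = x ^+ k.
  move=> ak; elim: t => [|t IHt]; first by rewrite addn0.
  have -> : (k + t.+1 * (b - a) = (k - a + t * (b - a)) + b)%N by rewrite mulSn; lia.
  by rewrite exprD -xab -exprD -IHt; congr (_ ^+ _); lia.
have ba : (0 < b - a)%N by rewrite subn_gt0.
exists (a.+1 * (b - a))%N; rewrite muln_gt0 ba; split=> //.
by rewrite -exprD per // (leq_trans (leqnSn a)) // leq_pmulr.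
Qed.

(** Minimal nonzero idempotents for the order in which [f] is below [e] when [f * e = f]. *)
Definition primitive (e : R) : bool := [&& e * e == e, e != 0 &
  [forall f : R, (f * f == f) && (f * e == f) ==> (f == 0) || (f == e)]].

Lemma primitiveP e : primitive e ->
  [/\ e * e = e, e != 0 & forall f, f * f = f -> f * e = f -> f = 0 \/ f = e].
Proof.
case/and3P=> /eqP ee e0 /forallP prim; split=> // f ff fe.
have := prim f; rewrite ff fe !eqxx => /orP[]/eqP; by [left|right].
Qed.

Lemma primitive_orthogonal e f : primitive e -> primitive f -> e != f -> e * f = 0.
Proof.
move=> /primitiveP[ee _ prime] /primitiveP[ff _ primf] nef.
have eff : e * f * (e * f) = e * f by rewrite mulrACA ee ff.
have efe : e * f * e = e * f by rewrite mulrAC ee.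
have eff' : e * f * f = e * f by rewrite -mulrA ff.
have [//|efE] := prime _ eff efe; have [//|efF] := primf _ eff eff'.
by rewrite -efE efF eqxx in nef.
Qed.

Lemma exists_primitive f : f * f = f -> f != 0 -> exists2 e, primitive e & e * f = e.
Proof.
pose P g := [&& g * g == g, g != 0 & g * f == g].
move=> ff f0; have Pf : P f by rewrite /P ff f0 eqxx.
have [e /and3P[/eqP ee e0 /eqP ef] emin] := @arg_minnP _ f P (fun g => #|principal g|) Pf.
exists e => //; rewrite /primitive ee e0 eqxx /=; apply/forallP => g.
apply/implyP => /andP[/eqP gg /eqP ge]; rewrite orbC -implyNb; apply/implyP => nge.
apply: contraR nge => g0.
have ge_sub : principal g \subset principal e.
  by rewrite principal_sub ?principal_is_ideal //; apply/principalP; exists g.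
have Pg : P g by rewrite /P gg g0 -ge -mulrA ef !eqxx.
have : e \in principal g.
  suff /eqP -> : principal g == principal e by apply: mem_principal.
  by rewrite eqEcard ge_sub emin.
by case/principalP => r er; rewrite -ge mulrC er -mulrA gg.
Qed.

(** By orthogonality the sum [s] is an idempotent fixing every primitive one. A primitive idempotent
    below [1 - s] would be killed by [1 - s], so [1 - s = 0]. *)
Lemma sum_primitive : \sum_(e | primitive e) e = 1.
Proof.
set s := \sum_(e | _) e.
have es e : primitive e -> e * s = e.
  move=> pe; rewrite /s (bigD1 e) //= mulrDr mulr_sumr big1 ?addr0.
    by case/primitiveP: pe.
  by move=> f /andP[pf nfe]; rewrite primitive_orthogonal // eq_sym.
have ss : s * s = s by rewrite {1}/s mulr_suml; apply: eq_bigr => e /es.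
apply/esym/eqP; rewrite -subr_eq0; apply: contraT => ns.
have [|e pe] := @exists_primitive (1 - s) _ ns.
  by rewrite mulrBr mulr1 mulrBl mul1r ss subrr subr0.
rewrite mulrBr mulr1 es // subrr => /esym/eqP.
by case/primitiveP: pe => _ /negPf->.
Qed.

(** A nonunit has an idempotent power, which must be 0, so nonunits are nilpotent. They form an
    ideal, whose generator is the uniformizer. *)
Lemma uniformizer_of_trivial_idempotents :
  (forall f : R, f * f = f -> f = 0 \/ f = 1) ->
  (forall I : {set R}, is_ideal I -> exists a, I = principal a) ->
  exists (p : R) m, uniformizer p m.
Proof.
move=> triv pR; pose nu := [set x : R | ~~ [exists y, x * y == 1]].
have unitP x y : x * y = 1 -> x \notin nu.
  by move=> xy; rewrite inE negbK; apply/existsP; exists y; apply/eqP.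
have nuM a x : x \in nu -> a * x \in nu.
  rewrite [in X in _ -> X]inE => xnu; apply/existsP => -[y /eqP axy].
  by move: xnu; apply/negP; apply: (@unitP x (a * y)); rewrite mulrCA mulrA.
have nilp x : x \in nu -> exists k, x ^+ k == 0.
  move=> xnu; have [k [k0 xk]] := exists_idempotent_power x; exists k.
  have [->//|xk1] := triv _ xk; move: xnu; rewrite (negPf (@unitP x (x ^+ k.-1) _)) //.
  by rewrite -exprS prednK.
have nu0 : 0 \in nu.
  by rewrite inE; apply/existsP => -[y]; rewrite mul0r eq_sym oner_eq0.
have [|p defnu] := pR nu.
  apply/is_idealP; split=> // a x y xnu ynu; rewrite inE; apply/existsP => -[z /eqP uz].
  have [k wk] := nilp _ (nuM (a * z) _ xnu).
  (* If [a * x + y] had inverse [z], then [z * y] would be 1 minus a nilpotent, a unit by the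
     geometric sum. *)
  have yz : z * y = 1 - a * z * x by rewrite -uz; ring.
  have := nuM z _ ynu; rewrite yz; apply/negP.
  have := subrX1 (a * z * x) k; rewrite (eqP wk) sub0r => /(congr1 -%R).
  by rewrite opprK -mulNr opprB => /esym/unitP.
have pnu : p \in nu by rewrite defnu mem_principal.
have ex := nilp _ pnu; exists p, (ex_minn ex).
case: ex_minnP => m /eqP pm mmin.
have m0 : (0 < m)%N by case: m pm {mmin} => // /eqP; rewrite expr0 oner_eq0.
split=> //; first by apply/negP => /mmin; lia.
move=> x; case: (boolP (x \in nu)) => [|].
  by rewrite defnu => /principalP; right.
by rewrite inE negbK => /existsP[y /eqP xy]; left; exists y.
Qed.

End PrimitiveIdempotents.

(** The idempotents of [eR] are those of [R] below [e], hence only 0 and [e]. *)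
Lemma primitive_corner_uniformizer (R : finComNzRingType) (e : R)
    (idem : e * e = e) (e0 : e != 0) : primitive e -> principal_ring R ->
  exists p m, uniformizer (p : corner_ring idem e0) m.
Proof.
move=> /primitiveP[_ _ prime] pR; apply: uniformizer_of_trivial_idempotents.
  move=> f /(congr1 val); rewrite val_cornerM => ff.
  have [f0|fe] := prime _ ff (corner_fix f); [left|right]; apply: val_inj.
    by rewrite f0 val_corner0.
  by rewrite fe val_corner1.
exact: corner_principal.
Qed.

(** * The isomorphism with the product of the corners *)

Section Decomposition.

Variable R : finComNzRingType.

Definition primitive_idempotents : {set R} := [set e | primitive e].
Local Notation n := #|primitive_idempotents|.

Definition primitive_at (i : 'I_n) : R := enum_val i.

Fact primitive_at_primitive i : primitive (primitive_at i).
Proof. by have := enum_valP i; rewrite inE. Qed.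

Fact primitive_at_idem i : primitive_at i * primitive_at i = primitive_at i.
Proof. by case/primitiveP: (primitive_at_primitive i). Qed.

Fact primitive_at_neq0 i : primitive_at i != 0.
Proof. by case/primitiveP: (primitive_at_primitive i). Qed.

Definition factor (i : 'I_n) : finComNzRingType :=
  corner_ring (primitive_at_idem i) (primitive_at_neq0 i).

Definition to_factors (x : R) : {dffun forall i : 'I_n, factor i} :=
  [ffun i => to_corner (primitive_at_idem i) (primitive_at_neq0 i) x].

Lemma val_to_factors x i : val (to_factors x i) = x * primitive_at i.
Proof. by rewrite ffunE. Qed.

Fact to_factors_is_zmod_morphism : zmod_morphism to_factors.
Proof.
move=> x y; apply/ffunP => i; apply: val_inj.
have -> : (to_factors x - to_factors y) i = to_factors x i - to_factors y i.
  by rewrite !ffunE.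
by rewrite val_cornerD val_corner_opp !val_to_factors mulrBl.
Qed.

Fact to_factors_is_monoid_morphism : monoid_morphism to_factors.
Proof.
split=> [|x y]; apply/ffunP => i; apply: val_inj.
  by rewrite !val_to_factors mul1r.
have -> : (to_factors x * to_factors y) i = to_factors x i * to_factors y i.
  by rewrite !ffunE.
by rewrite val_cornerM !val_to_factors mulrACA primitive_at_idem.
Qed.

HB.instance Definition _ := GRing.isZmodMorphism.Build R
  {dffun forall i : 'I_n, factor i} to_factors to_factors_is_zmod_morphism.
HB.instance Definition _ := GRing.isMonoidMorphism.Build R
  {dffun forall i : 'I_n, factor i} to_factors to_factors_is_monoid_morphism.

Lemma primitive_at_orthogonal i j : i != j -> primitive_at i * primitive_at j = 0.
Proof.
move=> nij; apply: primitive_orthogonal; rewrite ?primitive_at_primitive //.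
by apply: contra nij => /eqP/enum_val_inj ->.
Qed.

(** The inverse adds up the components: the idempotents have sum 1, and orthogonality isolates each
    component. *)
Lemma to_factors_bijective : bijective to_factors.
Proof.
exists (fun y : {dffun forall i : 'I_n, factor i} => \sum_i val (y i)) => [x|y].
  under eq_bigr do rewrite val_to_factors.
  have sum1 : \sum_i primitive_at i = 1.
    rewrite -sum_primitive; have -> : \sum_(e : R | primitive e) e =
        \sum_(e in primitive_idempotents) e by apply: eq_bigl => e; rewrite inE.
    exact/esym/big_enum_val.
  by rewrite -mulr_sumr sum1 mulr1.
apply/ffunP => i; apply: val_inj; rewrite val_to_factors mulr_suml (bigD1 i) //=.
rewrite corner_fix big1 ?addr0 // => j nji.
by rewrite -[val (y j)]corner_fix -mulrA primitive_at_orthogonal ?mulr0.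
Qed.

Lemma exists_chain_decomposition : principal_ring R ->
  exists m : 'I_n -> nat, (0 < n)%N /\ chain_decomposition R factor m.
Proof.
move=> pR; have n_gt0 : (0 < n)%N.
  rewrite card_gt0; apply/negP => /eqP p0; have := oner_neq0 R.
  rewrite -sum_primitive big_pred0 ?eqxx // => e.
  by have := in_set0 e; rewrite -p0 inE.
have uni i := primitive_corner_uniformizer (primitive_at_idem i) (primitive_at_neq0 i)
  (primitive_at_primitive i) pR.
have [m mP] : exists m : 'I_n -> nat, forall i, exists p : factor i, uniformizer p (m i).
  apply: (@fin_all_exists _ (fun=> nat) (fun i m => exists p : factor i, uniformizer p m)).
  by move=> i; have [p [m up]] := uni i; exists m, p.
exists m; split=> //; split.
  by exists to_factors; apply: to_factors_bijective.
move=> i; have [p up] := mP i; split.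
- exact: uniformizer_local up.
- exact: uniformizer_chain up.
exact: uniformizer_nilpotency up.
Qed.

End Decomposition.

(** * Exponent vectors of ideals *)

Section IdealExponents.

Variables (R : finComNzRingType) (n : nat).
Variables (S : 'I_n -> finComNzRingType) (m : 'I_n -> nat).
Local Notation prodS := {dffun forall i : 'I_n, S i}.
Variables (f : {rmorphism R -> prodS}) (g : prodS -> R) (p : forall i, S i).
Hypotheses (fK : cancel f g) (gK : cancel g f).
Hypothesis unif : forall i, uniformizer (p i) (m i).

Definition prime_power (a : 'I_n -> nat) : R := g [ffun i => p i ^+ a i].

Lemma prime_powerE a i : f (prime_power a) i = p i ^+ a i.
Proof. by rewrite gK ffunE. Qed.

Lemma prod_mulE x y i : f (x * y) i = f x i * f y i.
Proof. by rewrite rmorphM [LHS]ffunE. Qed.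

Lemma prod_inj x y : (forall i, f x i = f y i) -> x = y.
Proof. by move=> e; apply: (can_inj fK); apply/ffunP. Qed.

Lemma prod_eq0 x : (forall i, f x i = 0) -> x = 0.
Proof. by move=> e; apply: prod_inj => i; rewrite e rmorph0 [RHS]ffunE. Qed.

Lemma eq_prime_power a b : a =1 b -> prime_power a = prime_power b.
Proof. by move=> e; apply: prod_inj => i; rewrite !prime_powerE e. Qed.

Lemma prime_power_mul a b :
  prime_power a * prime_power b = prime_power (fun i => a i + b i)%N.
Proof. by apply: prod_inj => i; rewrite prod_mulE !prime_powerE exprD. Qed.

Lemma prime_power_eq0 a : (prime_power a == 0) = [forall i, m i <= a i]%N.
Proof.
apply/eqP/forallP => [a0 i|ma].
  by rewrite -(uniformizer_expr_eq0 _ (unif i)) -prime_powerE a0 rmorph0 [X in X == _]ffunE.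
apply: prod_eq0 => i; rewrite prime_powerE; apply/eqP.
by rewrite (uniformizer_expr_eq0 _ (unif i)).
Qed.

Lemma prime_power1 a : (forall i, a i = 0)%N -> prime_power a = 1.
Proof.
by move=> a0; apply: prod_inj => i; rewrite prime_powerE a0 rmorph1 [RHS]ffunE expr0.
Qed.

Lemma prime_power_dvd (a b : 'I_n -> nat) r : (forall i, b i <= m i)%N ->
  prime_power a = r * prime_power b -> forall i, (b i <= a i)%N.
Proof.
move=> bm e i; apply: uniformizer_dvd (unif i) (bm i) _.
by rewrite -!prime_powerE e prod_mulE; reflexivity.
Qed.

(** Each generator divides the other. The bounds by [m i] matter because all higher powers of [p i]
    vanish alike. *)
Lemma principal_prime_power_inj (a b : 'I_n -> nat) :
  (forall i, a i <= m i)%N -> (forall i, b i <= m i)%N ->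
  principal (prime_power a) = principal (prime_power b) -> a =1 b.
Proof.
move=> am bm e i; apply/eqP; rewrite eqn_leq; apply/andP; split.
  have := mem_principal (prime_power b); rewrite -e => /principalP[r re].
  exact: prime_power_dvd am re i.
have := mem_principal (prime_power a); rewrite e => /principalP[r re].
exact: prime_power_dvd bm re i.
Qed.

(** The unit factors of the components, and their inverses, assemble into elements of [R] that carry
    each generator to the other. *)
Lemma principal_prime_power x : exists2 a : 'I_n -> nat,
  (forall i, a i <= m i)%N & principal x = principal (prime_power a).
Proof.
have fact i := uniformizer_factor (f x i) (unif i).
have /fin_all_exists[u /fin_all_exists[v /fin_all_exists[a aP]]] := fact.
exists a; first by move=> i; case: (aP i).
have xE : x = g [ffun i => u i] * prime_power a.
  apply: prod_inj => i; rewrite prod_mulE prime_powerE gK ffunE.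
  by case: (aP i).
have aE : prime_power a = g [ffun i => v i] * x.
  apply: prod_inj => i; rewrite prod_mulE prime_powerE gK ffunE.
  by case: (aP i) => uv _ ->; rewrite mulrA (mulrC (v i)) uv mul1r.
apply/eqP; rewrite eqEsubset !principal_sub ?principal_is_ideal //.
apply/andP; split; apply/principalP; first by exists (g [ffun i => u i]).
by exists (g [ffun i => v i]).
Qed.

(** With all exponents zero the ideal is the whole ring, whose annihilator is zero; otherwise
    exponents [m i - a i] give a nonzero annihilating element. *)
Lemma AG_vertex_prime_power (a : 'I_n -> nat) : (forall i, a i <= m i)%N ->
  AG_vertex (principal (prime_power a)) =
    [exists i, 0 < a i]%N && [exists i, a i < m i]%N.
Proof.
move=> am; rewrite /AG_vertex principal_is_ideal principal_eq0 prime_power_eq0 andTb andbC.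
congr andb; last first.
  by rewrite negb_forall; apply: eq_existsb => i; rewrite -ltnNge.
apply/idP/existsP => [nann|[i ai]].
  apply/existsP; apply: contraR nann => /existsPn a0; apply/eqP/setP => r.
  rewrite prime_power1 ?principal1; last by move=> i; apply/eqP; rewrite -leqn0 leqNgt.
  rewrite !inE; apply/forall_inP/eqP => [/(_ 1)|->] => [|x _]; last by rewrite mul0r.
  by rewrite inE mulr1 => /(_ isT)/eqP.
pose b i := (m i - a i)%N.
have b0 : prime_power b != 0.
  rewrite prime_power_eq0; apply/forallPn; exists i.
  by rewrite /b; have := am i; lia.
apply: contraNneq b0 => ann0; rewrite -in_set1 -ann0 inE.
apply/forall_inP => x /principalP[r ->]; rewrite mulrCA prime_power_mul.
suff /eqP -> : prime_power (fun i => b i + a i)%N == 0 by rewrite mulr0.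
by rewrite prime_power_eq0; apply/forallP => j; rewrite /b subnK.
Qed.

Lemma exists_exponents : principal_ring R ->
  exists lev : {I : {set R} | AG_vertex I} -> 'I_n -> nat,
    forall v, (forall i, lev v i <= m i)%N /\ val v = principal (prime_power (lev v)).
Proof.
move=> pR; apply: (@fin_all_exists _ (fun=> 'I_n -> nat)
  (fun v a => (forall i, a i <= m i)%N /\ val v = principal (prime_power a))) => v.
have /and3P[idv _ _] := valP v; have [x vx] := principal_ring_gen pR idv.
by have [a am xa] := principal_prime_power x; exists a; rewrite vx.
Qed.

End IdealExponents.

(** * The dimension formulas for the ring *)

Lemma dim_AG_cases (R : finComNzRingType) (n : nat) (S : 'I_n -> finComNzRingType)
    (m : 'I_n -> nat) : principal_ring R -> chain_decomposition R S m ->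
  [/\ forall i, n = 1%N -> dim_AG R = ((m i - 1) %/ 2)%N,
      forall i j, n = 2%N -> i != j ->
        dim_AG R = (m i + m j - 2 + ((m i == 1) && (m j == 1)))%N
    & (3 <= n)%N -> (\sum_i m i - n + up_log 2 #|[set i | m i == 1]| <= dim_AG R)%N
        /\ (dim_AG R <= \sum_i m i)%N].
Proof.
move=> pR [[f [g fK gK]] loc].
have [p unif] : exists p : forall i, S i, forall i, uniformizer (p i) (m i).
  apply: (@fin_all_exists _ S (fun i x => uniformizer x (m i))) => i.
  by have [? ? ?] := loc i; apply: exists_uniformizer.
have m_gt0 i : (0 < m i)%N by case: (unif i).
have [lev levP] := exists_exponents fK gK unif pR.
have lev_le v i : (lev v i <= m i)%N by case: (levP v).
have lev_val v : val v = principal (prime_power g p (lev v)) by case: (levP v).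
have lev_inj v w : lev v =1 lev w -> v = w.
  by move=> e; apply: val_inj; rewrite !lev_val (eq_prime_power p fK gK e).
have levV v : [exists i, 0 < lev v i]%N && [exists i, lev v i < m i]%N.
  rewrite -(AG_vertex_prime_power fK gK unif (lev_le v)) -lev_val; exact: valP.
have lev_gt0 v : exists i, (0 < lev v i)%N by have /andP[/existsP] := levV v.
have lev_ltN v : exists i, (lev v i < m i)%N by have /andP[_ /existsP] := levV v.
have lev_onto (a : 'I_n -> nat) : (forall i, a i <= m i)%N ->
    (exists i, 0 < a i)%N -> (exists i, a i < m i)%N -> exists v, lev v =1 a.
  move=> am a0 aN; have Va : AG_vertex (principal (prime_power g p a)).
    by rewrite (AG_vertex_prime_power fK gK unif am); apply/andP; split; apply/existsP.
  exists (Sub _ Va); apply: (principal_prime_power_inj gK unif) => //.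
  by rewrite -lev_val SubK.
have edgeE v w : AG_edge v w = (v != w) && annihilates m lev v w.
  rewrite /AG_edge !lev_val ideal_mul_principal (prime_power_mul p fK gK).
  by rewrite principal_eq0 (prime_power_eq0 fK gK unif).
split=> [i n1|i j n2 nij|n3].
- have only k : k = i by apply: ord_inj; move: (ltn_ord k) (ltn_ord i); clear -n1; lia.
  have [m1|m1] := ltnP 1 (m i).
    (* Some vertex must serve as the default value of [vertex_of]; one exists because [1 < m i]. *)
    have [|||v _] := lev_onto (fun=> 1%N); first by move=> k; apply: m_gt0.
    + by exists i.
    + by exists i.
    exact: (metric_dim_one m_gt0 lev_inj lev_le lev_gt0 lev_ltN lev_onto edgeE v only).
  (* For a field there are no vertices, and the empty set is resolving. *)
  rewrite (_ : (m i - 1) %/ 2 = 0)%N; last by lia.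
  apply/eqP; rewrite -leqn0; have <- : #|set0 : {set {I : {set R} | AG_vertex I}}| = 0%N.
    exact: cards0.
  apply: metric_dim_le; apply/resolvingP => v.
  by have [k] := lev_gt0 v; have [l] := lev_ltN v; rewrite (only k) (only l); lia.
- have only k : (k == i) || (k == j).
    move: nij; rewrite -!val_eqE /=.
    by have := ltn_ord k; have := ltn_ord i; have := ltn_ord j; lia.
  have [|||v _] := lev_onto (fun k => if k == i then m i else 0%N).
  + by move=> k; case: eqP => [->|].
  + by exists i; rewrite eqxx.
  + by exists j; rewrite eq_sym (negPf nij).
  exact: (metric_dim_two m_gt0 lev_inj lev_le lev_gt0 lev_ltN lev_onto edgeE v nij only).
have third (i j : 'I_n) : exists k, (k != i) && (k != j).
  case: (pickP (fun k => (k != i) && (k != j))) => [k|none]; first by exists k.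
  have : (#|'I_n| <= #|[set i; j]|)%N.
    apply: subset_leq_card; apply/subsetP => k _; rewrite !inE.
    by rewrite -[_ || _]negbK negb_or none.
  by rewrite card_ord cards2 leqNgt (leq_trans _ n3) // ltnS; case: (i != j).
have others_all (i : 'I_n) : others i.
  by have [k /andP[ki _]] := third i i; apply/existsP; exists k.
have i0 : 'I_n := Ordinal (leq_trans (isT : 0 < 3)%N n3).
have [k /andP[ki0 _]] := third i0 i0.
have [|||v _] := lev_onto (fun j => if j == i0 then m i0 else 0%N).
- by move=> j; case: eqP => [->|].
- by exists i0; rewrite eqxx.
- by exists k; rewrite (negPf ki0).
split; last first.
  exact: (metric_dim_le_sum m_gt0 lev_inj lev_le lev_gt0 lev_ltN lev_onto edgeE v).
rewrite -[n in (_ - n)%N]card_ord.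
exact: (metric_dim_ge_sum m_gt0 lev_inj lev_le lev_gt0 lev_ltN lev_onto edgeE v).
Qed.

Close Scope ring_scope.
Unset Implicit Arguments.

Theorem theorem2p3 (R : finComNzRingType) (hR : principal_ring R) :
  (exists (n : nat) (S : 'I_n -> finComNzRingType) (m : 'I_n -> nat),
     (0 < n)%N /\ chain_decomposition R S m) /\
  (forall (n : nat) (S : 'I_n -> finComNzRingType) (m : 'I_n -> nat),
     chain_decomposition R S m ->
     [/\ forall i : 'I_n, n = 1%N -> dim_AG R = ((m i - 1) %/ 2)%N,
         forall i j : 'I_n, n = 2%N -> i <> j ->
           let eps : nat := if is_field (S i) && is_field (S j) then 1%N else 0%N in
           dim_AG R = (m i + m j - 2 + eps)%N
       & (3 <= n)%N ->
           let beta : nat := #|[set i : 'I_n | is_field (S i)]| in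
           let eps : nat := if beta == 0%N then 0%N else ceil_log2 beta in
           (((\sum_(i < n) m i) - n + eps <= dim_AG R)%N /\
            (dim_AG R <= \sum_(i < n) m i)%N)]).
Proof.
split.
  have [m [n0 dec]] := exists_chain_decomposition hR.
  by exists #|primitive_idempotents R|, (@factor R), m.
move=> n S m dec; have fieldE i : is_field (S i) = (m i == 1)%N.
  have [locS chS nilS] := dec.2 i.
  by have [p up] := exists_uniformizer locS chS nilS; apply: uniformizer_is_field up.
have [dim1 dim2 dim3] := dim_AG_cases hR dec; split.
- exact: dim1.
- move=> i j n2 /eqP nij eps; rewrite (dim2 i j) // /eps !fieldE.
  by case: (_ && _).
move=> n3 beta eps; have [lo hi] := dim3 n3; split=> //; move: lo.
(* The case [beta = 0] agrees with the general bound because [up_log 2 0 = 0]. *)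
rewrite /eps /beta /ceil_log2 (_ : [set i | is_field (S i)] = [set i | m i == 1%N]).
  by case: eqP => [->|].
by apply/setP => i; rewrite !inE fieldE.
Qed.
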